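(* Let $\widehat A,\widehat B,\widehat Q_x,\widehat Q_y\in\mathbb{Q}^{3\times3}$ and $\widehat b,\widehat c_1,\widehat c_2\in\mathbb{Q}^3$ be the rational data listed in the context. Then $\widehat Q_x,\widehat Q_y\succ0$ and $\det(\widehat A)\det(\widehat B)\ne0$. The direct ADMM iteration with $\beta=1$ (described in the context) applied to $$\min_{x,y,z\in\mathbb{R}^3}\ \tfrac12x^\top\widehat Q_xx+\widehat c_1^\top x+\tfrac12y^\top\widehat Q_yy+\widehat c_2^\top y+\iota_{\mathbb{R}_+^3}(z)\quad\text{s.t.}\quad\widehat Ax+\widehat By+z=\widehat b$$ has the following properties. (i) The problem has a unique primal–dual KKT point. (ii) Direct ADMM has a non-KKT sequence of minimal period $23$ (with phase-$k$ reduced states $\widehat v^k=(\widehat y^k,\widehat t^k)$, $0\le k<23$, as in the context). Its strict projection-sign word, i.e. the sequence of sign vectors of $\widehat t^0,\dots,\widehat t^{22}$, is $$\mathcal W_{23}=(+,-,+)^5\,(-,+,+)^7\,(-,-,+)^2\,(-,-,-)\,(-,-,+)^8,$$ where exponents denote consecutive repetitions. All $23\times3=69$ projection inputs are separated from zero: $$\min_{0\le k<23}\ \min_{1\le i\le3}|\widehat t_i^k|>\frac1{250}.$$ (iii) There is a rational matrix $P\succ0$ for which $$\mathcal E_{\rm cert}:=\left\{\widehat v^0+e:\ e^\top Pe<\tfrac1{4000}\right\}$$ is an open invariant set for the $23$-step return map $\Phi_{\rm per}$ defined in the context. Every $v^0\in\mathcal E_{\rm cert}$ follows the repeating sign pattern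 $\mathcal W_{23}$ and converges phasewise to the period-$23$ sequence, i.e. $v^{23\ell+j}\to\widehat v^j$ as $\ell\to\infty$ for each $0\le j<23$. Consequently, the reconstructed ADMM sequence is nonconvergent for every reduced initialization $v^0\in\mathcal E_{\rm cert}$.
   Context: Data: $$\widehat A=\begin{bmatrix}5/36&1/60&25/97\\1/60&5/77&5/91\\25/97&5/91&11/12\end{bmatrix},\qquad\widehat B=\begin{bmatrix}4/61&1/54&5/83\\1/54&13/92&23/88\\5/83&23/88&53/58\end{bmatrix},$$ $$\widehat Q_x=\begin{bmatrix}85/93&-1/57&-3/11\\-1/57&99/100&-5/86\\-3/11&-5/86&7/78\end{bmatrix},\qquad\widehat Q_y=\begin{bmatrix}99/100&-1/51&-3/47\\-1/51&72/79&-18/65\\-3/47&-18/65&4/43\end{bmatrix},$$ $$\widehat b=\begin{bmatrix}-2/17\\-1/14\\56/73\end{bmatrix},\qquad\widehat c_1=\begin{bmatrix}33/98\\-33/25\\-24/55\end{bmatrix},\qquad\widehat c_2=\begin{bmatrix}-31/99\\19/36\\-11/20\end{bmatrix}.$$ $\iota_C$ is the indicator function of $C$; $[a]_+$, $[a]_-$ are the componentwise $\max\{a_i,0\}$, $\min\{a_i,0\}$. Direct ADMM, $\beta=1$: with $\widehat K_x=(\widehat Q_x+\widehat A^\top\widehat A)^{-1}$, $\widehat K_y=(\widehat Q_y+\widehat B^\top\widehat B)^{-1}$, $$x^{k+1}=\widehat K_x[\widehat A^\top(\widehat b-\widehat By^k-z^k+\lambda^k)-\widehat c_1],\qquad y^{k+1}=\widehat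 K_y[\widehat B^\top(\widehat b-\widehat Ax^{k+1}-z^k+\lambda^k)-\widehat c_2],$$ $$t^{k+1}=\widehat b-\widehat Ax^{k+1}-\widehat By^{k+1}+\lambda^k,\qquad z^{k+1}=[t^{k+1}]_+,\qquad\lambda^{k+1}=\lambda^k-(\widehat Ax^{k+1}+\widehat By^{k+1}+z^{k+1}-\widehat b)=[t^{k+1}]_- .$$ These are the exact successive minimizations over $x,y,z$ of the augmented Lagrangian (objective $-\lambda^\top r+\frac12\|r\|^2$ with $r=\widehat Ax+\widehat By+z-\widehat b$), followed by the multiplier step. The projection input is $t=z+\lambda$. Reduced state. $v=(y,t)\in\mathbb{R}^6$, with $z=[t]_+$, $\lambda=[t]_-$; this determines the next step $v\mapsto v^+=(y^+,t^+)$, and the ADMM sequence ''reconstructed'' from $v^0$ is the one with $y^0$, $z^0=[t^0]_+$, $\lambda^0=[t^0]_-$ (the value $x^0$ does not influence later iterates). For a sign vector $\sigma\in\{-,+\}^3$ let $D_\sigma=\operatorname{diag}(\mathbf 1_{\{\sigma_i=+\}})$, and let $\Phi_\sigma:\mathbb{R}^6\to\mathbb{R}^6$ be the affine map obtained from the one-step reduced map by replacing $z=[t]_+$ by $z=D_\sigma t$ and $\lambda=[t]_-$ by $\lambda=(I_3-D_\sigma)t$; it agrees with the one-step reduced map wherever $t$ has strict sign vector $\sigma$. Write $\mathcal W_{23}=(\sigma_0,\dots,\sigma_{22})$ (the word displayed in the claim). The return map is $\Phi_{\rm per}=\Phi_{\sigma_{22}}\circ\cdots\circ\Phi_{\sigma_0}$,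 $\Phi_{\rm per}(v)=M_{\rm per}v+c_{\rm per}$; $I_6-M_{\rm per}$ is nonsingular and $\widehat v^0:=(I_6-M_{\rm per})^{-1}c_{\rm per}\in\mathbb{Q}^6$. For $0\le j<23$, $\widehat v^j=(\widehat y^j,\widehat t^j):=\Phi_{\sigma_{j-1}}\circ\cdots\circ\Phi_{\sigma_0}(\widehat v^0)$. ''$v^0$ follows the repeating pattern $\mathcal W_{23}$'' means that, for the reduced ADMM sequence $v^k=(y^k,t^k)$ started at $v^0$, $t^{23\ell+j}$ has strict sign vector $\sigma_j$ for all $\ell\ge0$, $0\le j<23$. A KKT point is $(x,y,z,\lambda)$ with $\widehat A^\top\lambda=\widehat Q_xx+\widehat c_1$, $\widehat B^\top\lambda=\widehat Q_yy+\widehat c_2$, $\widehat Ax+\widehat By+z=\widehat b$, $z\in\mathbb{R}_+^3$, $\lambda\in N_{\mathbb{R}_+^3}(z)$ (normal cone). A sequence is non-KKT if none of its elements is a KKT point. *)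

(* Defs.v *)
From HB Require Import structures.
From mathcomp Require Import all_boot all_order all_algebra.
From mathcomp Require Import all_classical all_reals all_analysis.

Set Implicit Arguments.
Unset Strict Implicit.
Unset Printing Implicit Defensive.

Import Order.TTheory GRing.Theory Num.Theory.
Import numFieldNormedType.Exports.

Local Open Scope classical_set_scope.
Local Open Scope ring_scope.

Definition mx_of_rows (m n : nat) (s : seq (seq rat)) : 'M[rat]_(m, n) :=
  \matrix_(i < m, j < n) nth 0 (nth [::] s i) j.

Definition cv_of_seq (n : nat) (s : seq rat) : 'cV[rat]_n :=
  \col_(i < n) nth 0 s i.

Definition Ahat : 'M[rat]_3 := mx_of_rows 3 3
  [:: [:: 5 / 36;  1 / 60; 25 / 97];
      [:: 1 / 60;  5 / 77;  5 / 91];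
      [:: 25 / 97; 5 / 91; 11 / 12]].

Definition Bhat : 'M[rat]_3 := mx_of_rows 3 3
  [:: [:: 4 / 61;  1 / 54;  5 / 83];
      [:: 1 / 54; 13 / 92; 23 / 88];
      [:: 5 / 83; 23 / 88; 53 / 58]].

Definition Qxhat : 'M[rat]_3 := mx_of_rows 3 3
  [:: [:: 85 / 93;    - (1 / 57); - (3 / 11)];
      [:: - (1 / 57);   99 / 100; - (5 / 86)];
      [:: - (3 / 11); - (5 / 86);     7 / 78]].

Definition Qyhat : 'M[rat]_3 := mx_of_rows 3 3
  [:: [:: 99 / 100;    - (1 / 51);  - (3 / 47)];
      [:: - (1 / 51);     72 / 79; - (18 / 65)];
      [:: - (3 / 47); - (18 / 65);      4 / 43]].

Definition bhat : 'cV[rat]_3 := cv_of_seq 3 [:: - (2 / 17); - (1 / 14); 56 / 73].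

Definition c1hat : 'cV[rat]_3 :=
  cv_of_seq 3 [:: 33 / 98; - (33 / 25); - (24 / 55)].

Definition c2hat : 'cV[rat]_3 :=
  cv_of_seq 3 [:: - (31 / 99); 19 / 36; - (11 / 20)].

Section LinearAlgebra.
Variable F : realFieldType.

Definition ofQ (m n : nat) (M : 'M[rat]_(m, n)) : 'M[F]_(m, n) :=
  map_mx ratr M.

Definition dot (n : nat) (u v : 'cV[F]_n) : F := (u^T *m v) 0 0.

Definition posdef (n : nat) (Q : 'M[F]_n) : Prop :=
  Q^T = Q /\ forall u : 'cV[F]_n, u != 0 -> 0 < dot u (Q *m u).

Definition pos_part (n : nat) (a : 'cV[F]_n) : 'cV[F]_n :=
  \col_i Num.max (a i 0) 0.

Definition neg_part (n : nat) (a : 'cV[F]_n) : 'cV[F]_n :=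
  \col_i Num.min (a i 0) 0.

Definition nonneg_orthant (n : nat) : set 'cV[F]_n :=
  [set z | forall i, 0 <= z i 0].

(* Empty when z lies outside C. *)
Definition normal_cone (n : nat) (C : set 'cV[F]_n) (z : 'cV[F]_n) :
    set 'cV[F]_n :=
  [set l | C z /\ forall w, C w -> dot l (w - z) <= 0].

(* For affine f : v |-> M v + c this is M, and c is f 0. *)
Definition linear_part (n : nat) (f : 'cV[F]_n -> 'cV[F]_n) : 'M[F]_n :=
  \matrix_(i, j) (f (delta_mx j 0) - f 0) i 0.

Lemma linear_partE (n : nat) (f : 'cV[F]_n -> 'cV[F]_n) (M : 'M[F]_n)
    (c : 'cV[F]_n) :
  (forall v, f v = M *m v + c) -> linear_part f = M.
Proof.
move=> fE; apply/matrixP => i j.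
by rewrite mxE !fE mulmx0 add0r addrK -colE mxE.
Qed.

End LinearAlgebra.

(* (x, y, z, lambda); a notation, so that the product topology is inferred *)
Notation state F := ('cV[F]_3 * 'cV[F]_3 * 'cV[F]_3 * 'cV[F]_3)%type.

Section ADMM.
Variable F : realFieldType.

Local Notation A := (ofQ F Ahat).
Local Notation B := (ofQ F Bhat).
Local Notation Qx := (ofQ F Qxhat).
Local Notation Qy := (ofQ F Qyhat).
Local Notation b := (ofQ F bhat).
Local Notation c1 := (ofQ F c1hat).
Local Notation c2 := (ofQ F c2hat).

Definition is_KKT (w : state F) : Prop :=
  let: (x, y, z, l) := w in
  [/\ A^T *m l = Qx *m x + c1,
      B^T *m l = Qy *m y + c2,
      A *m x + B *m y + z = b,
      nonneg_orthant z &
      normal_cone (@nonneg_orthant F 3) z l].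

Definition Kx : 'M[F]_3 := invmx (Qx + A^T *m A).
Definition Ky : 'M[F]_3 := invmx (Qy + B^T *m B).

Definition x_update (y z l : 'cV[F]_3) : 'cV[F]_3 :=
  Kx *m (A^T *m (b - B *m y - z + l) - c1).

Definition y_update (x z l : 'cV[F]_3) : 'cV[F]_3 :=
  Ky *m (B^T *m (b - A *m x - z + l) - c2).

Definition t_update (x y l : 'cV[F]_3) : 'cV[F]_3 :=
  b - A *m x - B *m y + l.

Definition admm_step (w : state F) : state F :=
  let: (x, y, z, l) := w in
  let x' := x_update y z l in
  let y' := y_update x' z l in
  let z' := pos_part (t_update x' y' l) in
  let l' := l - (A *m x' + B *m y' + z' - b) in
  (x', y', z', l').

Definition admm_seq (w0 : state F) (k : nat) : state F := iter k admm_step w0.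

(* A reduced state v = (y, t) is the block column col_mx y t. *)
Definition reduced_state (w : state F) : 'cV[F]_(3 + 3) :=
  let: (x, y, z, l) := w in col_mx y (z + l).

Definition reconstruct (x0 : 'cV[F]_3) (v0 : 'cV[F]_(3 + 3)) : state F :=
  (x0, usubmx v0, pos_part (dsubmx v0), neg_part (dsubmx v0)).

Definition reduced_update (y z l : 'cV[F]_3) : 'cV[F]_(3 + 3) :=
  let x' := x_update y z l in
  let y' := y_update x' z l in
  col_mx y' (t_update x' y' l).

Definition reduced_map (v : 'cV[F]_(3 + 3)) : 'cV[F]_(3 + 3) :=
  reduced_update (usubmx v) (pos_part (dsubmx v)) (neg_part (dsubmx v)).

Definition reduced_seq (v0 : 'cV[F]_(3 + 3)) (k : nat) : 'cV[F]_(3 + 3) :=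
  iter k reduced_map v0.

(* Sign vectors: true stands for + and false for -. *)
Definition Dsign (s : 3.-tuple bool) : 'M[F]_3 :=
  diag_mx (\row_i (tnth s i)%:R).

Definition Phi (s : 3.-tuple bool) (v : 'cV[F]_(3 + 3)) : 'cV[F]_(3 + 3) :=
  reduced_update (usubmx v) (Dsign s *m dsubmx v)
                 ((1%:M - Dsign s) *m dsubmx v).

(* The first letter of the word acts first. *)
Definition Phi_word (w : seq (3.-tuple bool)) (v : 'cV[F]_(3 + 3)) :
    'cV[F]_(3 + 3) :=
  foldl (fun u s => Phi s u) v w.

Definition strict_sign (s : 3.-tuple bool) (t : 'cV[F]_3) : Prop :=
  forall i : 'I_3, if tnth s i then 0 < t i 0 else t i 0 < 0.

End ADMM.

Definition W23 : seq (3.-tuple bool) :=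
  nseq 5 [tuple true; false; true] ++ nseq 7 [tuple false; true; true] ++
  nseq 2 [tuple false; false; true] ++ [:: [tuple false; false; false]] ++
  nseq 8 [tuple false; false; true].

Definition sigma (j : nat) : 3.-tuple bool :=
  nth [tuple false; false; false] W23 j.

Section Cycle.
Variable F : realFieldType.

Definition Phi_per : 'cV[F]_(3 + 3) -> 'cV[F]_(3 + 3) := @Phi_word F W23.

Definition M_per : 'M[F]_(3 + 3) := linear_part Phi_per.
Definition c_per : 'cV[F]_(3 + 3) := Phi_per 0.

Lemma Phi_affine (s : 3.-tuple bool) :
  exists M c, forall v : 'cV[F]_(3 + 3), Phi s v = M *m v + c.
Proof.
pose aff (f : 'cV[F]_(3 + 3) -> 'cV[F]_3) :=
  exists (M : 'M[F]_(3, 3 + 3)) (c : 'cV[F]_3), forall v, f v = M *m v + c.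
have affC c : aff (fun=> c) by exists 0, c => v; rewrite mul0mx add0r.
have affD f g : aff f -> aff g -> aff (fun v => f v + g v).
  move=> [M [c fE]] [N [d gE]]; exists (M + N), (c + d) => v.
  by rewrite fE gE mulmxDl addrACA.
have affM (N : 'M[F]_3) f : aff f -> aff (fun v => N *m f v).
  move=> [M [c fE]]; exists (N *m M), (N *m c) => v.
  by rewrite fE mulmxDr mulmxA.
have affN f : aff f -> aff (fun v => - f v).
  move=> [M [c fE]]; exists (- M), (- c) => v.
  by rewrite fE opprD mulNmx.
have affu : aff usubmx.
  exists (row_mx 1%:M 0), 0 => v.
  by rewrite -{2}[v]vsubmxK mul_row_col mul1mx mul0mx !addr0.
have affd : aff dsubmx.
  exists (row_mx 0 1%:M), 0 => v.
  by rewrite -{2}[v]vsubmxK mul_row_col mul1mx mul0mx addr0 add0r.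
pose z v := Dsign F s *m @dsubmx _ 3 3 1 v.
pose l v := (1%:M - Dsign F s) *m @dsubmx _ 3 3 1 v.
pose x v := x_update (usubmx v) (z v) (l v).
pose y v := y_update (x v) (z v) (l v).
have affz : aff z by exact: affM.
have affl : aff l by exact: affM.
have affB f g : aff f -> aff g -> aff (fun v => f v - g v).
  by move=> af ag; apply: (affD _ _ af (affN _ ag)).
have affx : aff x.
  exact: (affM (Kx F) _ (affB _ _ (affM _ _ (affD _ _ (affB _ _
    (affB _ _ (affC _) (affM _ _ affu)) affz) affl)) (affC _))).
have affy : aff y.
  exact: (affM (Ky F) _ (affB _ _ (affM _ _ (affD _ _ (affB _ _
    (affB _ _ (affC _) (affM _ _ affx)) affz) affl)) (affC _))).
have afft : aff (fun v => t_update (x v) (y v) (l v)).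
  exact: (affD _ _ (affB _ _ (affB _ _ (affC _) (affM _ _ affx))
    (affM _ _ affy)) affl).
have [[M [c yE]] [N [d tE]]] := (affy, afft).
exists (col_mx M N), (col_mx c d) => v.
by rewrite mul_col_mx add_col_mx -yE -tE.
Qed.

Lemma Phi_perE (v : 'cV[F]_(3 + 3)) : Phi_per v = M_per *m v + c_per.
Proof.
have [M [c PE]] : exists M c, forall u, Phi_per u = M *m u + c.
  rewrite /Phi_per; elim: W23 => [|s w [M [c wE]]].
    by exists 1%:M, 0 => u; rewrite mul1mx addr0.
  have [N [d sE]] := Phi_affine s.
  exists (M *m N), (M *m d + c) => u.
  by rewrite /= -/(Phi_word _ _) wE sE mulmxDr mulmxA addrA.
by rewrite /M_per (linear_partE PE) /c_per !PE mulmx0 add0r.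
Qed.

Definition vhat0 : 'cV[F]_(3 + 3) := invmx (1%:M - M_per) *m c_per.

Definition vhat (j : nat) : 'cV[F]_(3 + 3) := Phi_word (take j W23) vhat0.

Definition that (j : nat) : 'cV[F]_3 := dsubmx (vhat j).

Definition follows_W23 (v0 : 'cV[F]_(3 + 3)) : Prop :=
  forall l j : nat, (j < 23)%N ->
    strict_sign (sigma j) (dsubmx (reduced_seq v0 (23 * l + j))).

Definition E_cert (P : 'M[rat]_(3 + 3)) : set 'cV[F]_(3 + 3) :=
  [set v | exists2 e, v = vhat0 + e & dot e (ofQ F P *m e) < 1 / 4000].

End Cycle.

Arguments E_cert F P : clear implicits.

Definition minimal_period (T : Type) (p : nat) (u : nat -> T) : Prop :=
  [/\ (0 < p)%N, forall k, u (k + p)%N = u k &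
      forall q, (0 < q < p)%N -> ~ (forall k, u (k + q)%N = u k)].

(* Main.v *)
Require Import Defs.
From HB Require Import structures.
From Stdlib Require Import ZArith.
From mathcomp Require Import all_boot all_order all_algebra.
From mathcomp Require Import all_classical all_reals all_analysis.
From mathcomp Require Import zify ssrZ ring lra.

Set Implicit Arguments.
Unset Strict Implicit.
Unset Printing Implicit Defensive.

Import Order.TTheory GRing.Theory Num.Theory.
Import numFieldNormedType.Exports.

Local Open Scope classical_set_scope.
Local Open Scope ring_scope.

Local Delimit Scope Z_scope with BZ.

(** The proof is computer-assisted: a finite computation with enclosures of
matrices, checked by the kernel, and soft arguments that turn its outcome into
the theorem.

On the states v = (y, t) whose t has sign vector s, the reduced map is the affine
map Phi s v = N_s v + d_s, and the return map of the word is affine with linear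
part M, the product of the 23 matrices N_s. The exact fixed point of the return
map is rational, but with thousands of digits, so matrices are enclosed in balls:
an integer midpoint in units of 2^-80 and an integer radius. Products propagate
balls, and approx_inverse turns any approximate inverse with a small residue into
a proof of invertibility together with an enclosure of the inverse. The
computation (certificate) establishes five facts:
- the absolute row sums of the N_s are at most 2;
- 1 - M is invertible, and its enclosed inverse encloses the fixed point v^0;
- the 23 images of v^0 have the signs of the word, with entries beyond 1/250;
- the absolute row sums of M^16 are at most 1/5;
- 1 - N_s is invertible for s = (-,-,+), and the fixed point of Phi s has sign
  vector s.

The last fact gives a fixed point of the reduced map, which is a KKT point
(fixed_KKT); uniqueness is the monotonicity argument for strongly convex
quadratics, A being invertible. Conversely ADMM fixes KKT points, so a periodic
sequence that moves contains none. The signs of the orbit make v^0 a point of a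
true ADMM cycle, and they alone exclude the smaller periods.

For the basin, let q(e) be the sum of the squared lengths of e, M e, ..., M^15 e.
Then q(M e) = q(e) + |M^16 e|^2 - |e|^2 <= q(e) - (3/4) |e|^2, because M^16 is so
small (energy_M_per). Hence the ellipsoids q(e) < r are invariant under the return
map, and as q converges along the iterates, its decrements, hence |e|, tend to 0.
The matrix P is 4^25 times the matrix of q, a rational matrix since all data are
rational. The factor makes the ellipsoid so small that over one period, whose
steps at most double the norm, deviations stay below 1/250, the margin of the
signs of the cycle; so the true dynamics coincides with the affine one on it. *)

(** * The maximum norm and approximate inverses *)

Section MaxNorm.
Variable F : realFieldType.

Lemma entry_le_norm m n (A : 'M[F]_(m, n)) i j : `|A i j| <= `|A|.
Proof.
rewrite [leRHS]/Num.norm /= mx_normrE; apply/bigmax_geP; right.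
by exists (i, j).
Qed.

Lemma norm_le_entries m n (A : 'M[F]_(m, n)) c :
  0 <= c -> (forall i j, `|A i j| <= c) -> `|A| <= c.
Proof.
move=> c0 Ac; rewrite [leLHS]/Num.norm /= mx_normrE.
by apply/bigmax_leP; split => // -[i j] _; exact: Ac.
Qed.

Lemma norm_mulmx_rows m k n (A : 'M[F]_(m, k)) (B : 'M[F]_(k, n)) r :
  0 <= r -> (forall i, \sum_l `|A i l| <= r) -> `|A *m B| <= r * `|B|.
Proof.
move=> r0 Ar; apply: norm_le_entries => [|i j]; first by rewrite mulr_ge0.
rewrite mxE (le_trans (ler_norm_sum _ _ _)) //.
apply: le_trans (_ : (\sum_l `|A i l|) * `|B| <= _).
  by rewrite mulr_suml ler_sum // => l _; rewrite normrM ler_wpM2l ?entry_le_norm.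
by rewrite ler_wpM2r.
Qed.

Lemma norm_mulmx m k n (A : 'M[F]_(m, k)) (B : 'M[F]_(k, n)) :
  `|A *m B| <= k%:R * `|A| * `|B|.
Proof.
apply: norm_mulmx_rows => [|i]; first by rewrite mulr_ge0.
apply: le_trans (_ : \sum_(l < k) `|A| <= _).
  by apply: ler_sum => l _; exact: entry_le_norm.
by rewrite sumr_const card_ord -[leLHS]mulr_natl.
Qed.

(** A row vector u in the kernel of 1 - E satisfies u = u E, which a norm
below 1 makes impossible unless u = 0: this is the Neumann argument without
the series. *)
Lemma unitmx_near1 n (E : 'M[F]_n) :
  n%:R * `|E| <= 1 / 2 -> 1%:M - E \in unitmx.
Proof.
move=> nE; rewrite -row_free_unit -kermx_eq0; apply/rowV0P => u /sub_kermxP.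
rewrite mulmxBr mulmx1 => /subr0_eq uE.
apply/eqP; rewrite -normr_le0.
have := norm_mulmx u E; rewrite -uE mulrAC.
have := normr_ge0 u; have := ler_wpM2r (normr_ge0 u) nE; lra.
Qed.

(** With E = 1 - X A one has A^-1 - X = E A^-1, so a small residual E makes A
invertible and bounds the error of X. *)
Lemma approx_inverse n (A X : 'M[F]_n) (d : F) :
  `|1%:M - X *m A| <= d -> n%:R * d <= 1 / 2 ->
  A \in unitmx /\ `|invmx A - X| <= 2 * n%:R * d * `|X|.
Proof.
set E := 1%:M - X *m A => Ed nd.
have nE : n%:R * `|E| <= 1 / 2 by apply: le_trans nd; rewrite ler_wpM2l.
have uA : A \in unitmx.
  have: X *m A \in unitmx by rewrite -[X *m A](subKr 1%:M) unitmx_near1.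
  by rewrite unitmx_mul => /andP[].
split=> //.
have eE : invmx A - X = E *m invmx A.
  by rewrite mulmxBl mul1mx -mulmxA mulmxV // mulmx1.
have leE : `|invmx A - X| <= n%:R * d * `|invmx A|.
  by rewrite eE (le_trans (norm_mulmx _ _)) // ler_wpM2r // ler_wpM2l.
have d0 : 0 <= n%:R * d by rewrite mulr_ge0 // (le_trans _ Ed).
have: `|invmx A| <= `|X| + `|invmx A - X|.
  by rewrite -{1}(subrK X (invmx A)) addrC ler_normD.
have := ler_wpM2r (normr_ge0 (invmx A)) nd.
move: leE; set c := _ * d; move=> leE h1 h2.
have h3 : `|invmx A| <= 2 * `|X| by lra.
have -> : 2 * n%:R * d * `|X| = c * (2 * `|X|) by rewrite /c; ring.
by rewrite (le_trans leE) // ler_wpM2l.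
Qed.

End MaxNorm.

(** * Enclosures of matrices by fixed-point balls *)

(* Along the computation radii grow to about 2^60 units, so 80 bits leave the orbit
an accuracy near 2^-20, against a tightest margin of 5 * 10^-4. *)
Definition prec : Z := 80.
Definition fixed1 : Z := Z.shiftl 1 prec.


Arguments fixed1 : simpl never.
Arguments Z.mul : simpl never.

Lemma fixed1_gt0 : (0 < fixed1)%BZ.
Proof. by []. Qed.

Definition zmat := seq (seq Z).
Definition entry (X : zmat) (i j : nat) : Z := nth Z0 (nth [::] X i) j.
Definition table (m n : nat) (f : nat -> nat -> Z) : zmat :=
  mkseq (fun i => mkseq (f i) n) m.

Lemma entry_table m n f i j :
  (i < m)%N -> (j < n)%N -> entry (table m n f) i j = f i j.
Proof. by move=> im jn; rewrite /entry nth_mkseq // nth_mkseq. Qed.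

Definition zsum (n : nat) (f : nat -> Z) : Z :=
  foldr (fun i a => Z.add (f i) a) Z0 (iota 0 n).
Definition zmax (n : nat) (f : nat -> Z) : Z :=
  foldr (fun i a => Z.max (f i) a) Z0 (iota 0 n).

Lemma zmax_ge0 n f : (0 <= zmax n f)%BZ.
Proof. by rewrite /zmax; elim: (iota 0 n) => //= i s; lia. Qed.

Lemma le_zmax n f i : (i < n)%N -> (f i <= zmax n f)%BZ.
Proof.
move=> lt_in; have: i \in iota 0 n by rewrite mem_iota.
rewrite /zmax; elim: (iota 0 n) => //= k s IH.
by rewrite inE => /predU1P[<-|/IH]; lia.
Qed.

Definition max_entry m n (X : zmat) : Z :=
  zmax m (fun i => zmax n (fun j => Z.abs (entry X i j))).
Definition max_row m n (X : zmat) : Z :=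
  zmax m (fun i => zsum n (fun j => Z.abs (entry X i j))).

(** The matrices within rad of mid in the maximum norm, both in units of
2^-prec. Dimensions are arguments of the operations, as lists do not carry
them. *)
Record ball := Ball { mid : zmat; rad : Z }.

Definition scaledown (z : Z) : Z := Z.shiftr z prec.
Arguments scaledown : simpl never.

Definition ball_exact m n (f : nat -> nat -> Z) : ball := Ball (table m n f) 0.

Definition ball_one n : ball :=
  ball_exact n n (fun i j => if i == j then fixed1 else 0%BZ).

Definition ball_zero m n : ball := ball_exact m n (fun _ _ => 0%BZ).

Definition ball_ratio m n (q : seq (seq (Z * Z))) : ball :=
  Ball (table m n (fun i j => let x := nth (0, 1)%BZ (nth [::] q i) j in
                              Z.div (fixed1 * x.1) x.2)) 1.

Definition ball_add m n (a b : ball) : ball :=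
  Ball (table m n (fun i j => (entry (mid a) i j + entry (mid b) i j)%BZ))
       (rad a + rad b).

Definition ball_sub m n (a b : ball) : ball :=
  Ball (table m n (fun i j => (entry (mid a) i j - entry (mid b) i j)%BZ))
       (rad a + rad b).

Definition ball_tr m n (a : ball) : ball :=
  Ball (table n m (fun i j => entry (mid a) j i)) (rad a).

Definition ball_up p n (a : ball) : ball :=
  Ball (table p n (entry (mid a))) (rad a).

Definition ball_down p q n (a : ball) : ball :=
  Ball (table q n (fun i j => entry (mid a) (p + i) j)) (rad a).

Definition ball_col p q n (a b : ball) : ball :=
  Ball (table (p + q) n (fun i j => if (i < p)%N then entry (mid a) i j
                                    else entry (mid b) (i - p) j))
       (Z.max (rad a) (rad b)).

(* The 2 pays for the two roundings, of the midpoint and of the radius. *)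
Definition ball_mul m k n (a b : ball) : ball :=
  Ball (table m n (fun i j => scaledown
          (zsum k (fun l => (entry (mid a) i l * entry (mid b) l j)%BZ))))
       (scaledown (Z.of_nat k * rad a * (max_entry k n (mid b) + rad b)
                   + max_row m k (mid a) * rad b) + 2).

(** Newton's iteration X <- X (2 - S X). It only proposes an approximate
inverse; the quality of the proposal is measured afterwards. *)
Fixpoint newton n (k : nat) (S X : ball) : ball :=
  if k is k'.+1 then
    let D := ball_sub n n (ball_one n) (ball_mul n n n S X) in
    newton n k' S (Ball (mid (ball_add n n X (ball_mul n n n X D))) 0)
  else X.

Definition ball_residue n (X S : ball) : Z :=
  let E := ball_sub n n (ball_one n) (ball_mul n n n X S) in
  (max_entry n n (mid E) + rad E)%BZ.

(** The enclosure of the inverse of S around its approximation X, following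
approx_inverse; inv_ok is the hypothesis on the residue that it requires. *)
Definition ball_inv n (X S : ball) : ball :=
  Ball (mid X) (scaledown (2 * Z.of_nat n * ball_residue n X S
                           * max_entry n n (mid X)) + 1).

Definition inv_ok n (X S : ball) : bool :=
  (2 * Z.of_nat n * ball_residue n X S <=? fixed1)%BZ && (rad X =? 0)%BZ.

Section Enclosure.
Variable F : realFieldType.

(** Locked, lest unification unfold the image of a large integer into unary
arithmetic. *)
Definition ofZ : Z -> F := locked (fun z => (int_of_Z z)%:~R).

Lemma ofZE z : ofZ z = (int_of_Z z)%:~R.
Proof. by rewrite /ofZ -lock. Qed.

Lemma ofZD a b : ofZ (a + b)%BZ = ofZ a + ofZ b.
Proof. by rewrite !ofZE -intrD -[in RHS]rmorphD. Qed.

Lemma ofZN a : ofZ (- a)%BZ = - ofZ a.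
Proof. by rewrite !ofZE -rmorphN -[in RHS]rmorphN. Qed.

Lemma ofZB a b : ofZ (a - b)%BZ = ofZ a - ofZ b.
Proof. by rewrite -ofZN -ofZD. Qed.

Lemma ofZM a b : ofZ (a * b)%BZ = ofZ a * ofZ b.
Proof. by rewrite !ofZE -intrM -[in RHS]rmorphM. Qed.

Lemma ofZ0 : ofZ 0 = 0.
Proof. by rewrite ofZE. Qed.

Lemma ofZ_pos p : ofZ (Zpos p) = (Pos.to_nat p)%:R.
Proof. by rewrite ofZE. Qed.

Lemma ofZ_neg p : ofZ (Zneg p) = - (Pos.to_nat p)%:R.
Proof. by rewrite -ofZ_pos -ofZN. Qed.

Lemma ofZ2 : ofZ 2 = 2.
Proof. exact: ofZ_pos. Qed.

Lemma ofZ_nat n : ofZ (Z.of_nat n) = n%:R.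
Proof. case: n => [|n]; first by rewrite ofZ0.
by rewrite ofZ_pos SuccNat2Pos.id_succ. Qed.

Lemma ler_ofZ a b : (a <= b)%BZ -> ofZ a <= ofZ b.
Proof.
move=> ab; rewrite -subr_ge0 -ofZB.
by rewrite (_ : b - a = Z.of_nat (Z.to_nat (b - a)))%BZ ?ofZ_nat //; lia.
Qed.

Lemma ltr_ofZ a b : (a < b)%BZ -> ofZ a < ofZ b.
Proof.
move=> ab; rewrite -subr_gt0 -ofZB.
by rewrite (_ : b - a = Z.of_nat (Z.to_nat (b - a - 1)).+1)%BZ ?ofZ_nat ?ltr0Sn //; lia.
Qed.

Lemma ofZ_ge0 a : (0 <= a)%BZ -> 0 <= ofZ a.
Proof. by move/ler_ofZ; rewrite ofZ0. Qed.

Lemma ofZ_gt0 a : (0 < a)%BZ -> 0 < ofZ a.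
Proof. by move/ltr_ofZ; rewrite ofZ0. Qed.

Lemma ofZ_abs a : ofZ (Z.abs a) = `|ofZ a|.
Proof.
case: (Z.abs_spec a) => -[a0 ->]; first by rewrite ger0_norm // (ofZ_ge0 a0).
have := ltr_ofZ a0; rewrite ofZ0 => za0.
by rewrite ofZN ltr0_norm.
Qed.

Lemma ofZ_sum n f : ofZ (zsum n f) = \sum_(i < n) ofZ (f i).
Proof.
rewrite -(big_mkord xpredT (fun i => ofZ (f i))) /index_iota subn0 /zsum.
by elim: (iota 0 n) => [|i s IH]; rewrite ?big_nil ?big_cons /= ?ofZ0 // ofZD IH.
Qed.

Definition scale : F := ofZ fixed1.

Lemma scale_gt0 : 0 < scale.
Proof. exact: ofZ_gt0 fixed1_gt0. Qed.

Lemma scaledown_le z : ofZ z <= scale * (ofZ (scaledown z) + 1).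
Proof.
have <- : ofZ 1 = 1 := ofZ_pos 1; rewrite -ofZD -ofZM; apply: ler_ofZ; rewrite /scaledown.
rewrite Z.shiftr_div_pow2 // -[(2 ^ prec)%BZ]/fixed1.
by have := Z.mul_succ_div_gt z fixed1 fixed1_gt0; lia.
Qed.

Lemma scaledown_ge z : scale * ofZ (scaledown z) <= ofZ z.
Proof.
rewrite -ofZM; apply: ler_ofZ; rewrite /scaledown.
rewrite Z.shiftr_div_pow2 // -[(2 ^ prec)%BZ]/fixed1.
by have := Z.mul_div_le z fixed1 fixed1_gt0; lia.
Qed.

Definition zmx m n (X : zmat) : 'M[F]_(m, n) := \matrix_(i, j) ofZ (entry X i j).

Lemma zmx_table m n (f : nat -> nat -> Z) : zmx m n (table m n f) = \matrix_(i, j) ofZ (f i j).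
Proof. by apply/matrixP => i j; rewrite !mxE entry_table. Qed.

Lemma norm_zmx m n X : `|zmx m n X| <= ofZ (max_entry m n X).
Proof.
apply: norm_le_entries => [|i j]; first exact/ofZ_ge0/zmax_ge0.
rewrite mxE -ofZ_abs; apply/ler_ofZ.
have h1 := @le_zmax n (fun j => Z.abs (entry X i j)) j (ltn_ord j).
have := @le_zmax m (fun i => zmax n (fun j => Z.abs (entry X i j))) i (ltn_ord i).
rewrite /max_entry; lia.
Qed.

Lemma rows_zmx m n X i : \sum_j `|zmx m n X i j| <= ofZ (max_row m n X).
Proof.
rewrite (eq_bigr (fun j : 'I_n => ofZ (Z.abs (entry X i j)))); last first.
  by move=> j _; rewrite mxE ofZ_abs.
rewrite -(ofZ_sum _ (fun j => Z.abs (entry X i j))); apply/ler_ofZ.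
exact: (@le_zmax m (fun i => zsum n (fun j => Z.abs (entry X i j)))).
Qed.

Definition encloses m n (a : ball) (A : 'M[F]_(m, n)) : Prop :=
  `|scale *: A - zmx m n (mid a)| <= ofZ (rad a).

Lemma encloses_exact m n (f : nat -> nat -> Z) (A : 'M[F]_(m, n)) :
  (forall i j, scale * A i j = ofZ (f i j)) -> encloses (ball_exact m n f) A.
Proof.
move=> Af; rewrite /encloses zmx_table.
rewrite (_ : _ - _ = 0) ?normr0 /= ?ofZ0 //; apply/matrixP => i j.
by rewrite !mxE Af subrr.
Qed.

Lemma encloses_one n : encloses (ball_one n) (1%:M : 'M[F]_n).
Proof.
apply: encloses_exact => i j; rewrite mxE -val_eqE.
by case: eqP => _; rewrite ?mulr1 ?mulr0 ?ofZ0.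
Qed.

Lemma encloses_zero m n : encloses (ball_zero m n) (0 : 'M[F]_(m, n)).
Proof. by apply: encloses_exact => i j; rewrite mxE mulr0 ofZ0. Qed.

Definition has_ratios m n (q : seq (seq (Z * Z))) (A : 'M[F]_(m, n)) : Prop :=
  forall (i : 'I_m) (j : 'I_n), let x := nth (0, 1)%BZ (nth [::] q i) j in
    (0 < x.2)%BZ /\ A i j = ofZ x.1 / ofZ x.2.

Lemma encloses_ratio m n q (A : 'M[F]_(m, n)) :
  has_ratios q A -> encloses (ball_ratio m n q) A.
Proof.
move=> Aq; apply: norm_le_entries => [|i j]; first exact: ofZ_ge0.
rewrite zmx_table !mxE; have [x0 ->] := Aq i j.
move: (nth _ _ _) x0 => [a b] /= b0.
have zb0 : 0 < ofZ b := ofZ_gt0 b0.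
rewrite -(ler_pM2l zb0) -{1}(gtr0_norm zb0) -normrM mulrBr.
rewrite mulrCA [ofZ b * _]mulrC divfK ?gt_eqF //.
rewrite -!ofZM -ofZB -ofZ_abs; apply: ler_ofZ.
have := Z.mul_succ_div_gt (fixed1 * a) b b0.
have := Z.mul_div_le (fixed1 * a) b b0.
lia.
Qed.

Lemma encloses_add m n a b (A B : 'M[F]_(m, n)) :
  encloses a A -> encloses b B -> encloses (ball_add m n a b) (A + B).
Proof.
move=> Aa Bb; rewrite /encloses zmx_table ofZD.
apply: le_trans (lerD Aa Bb); apply: le_trans (ler_normD _ _).
rewrite le_eqVlt; apply/orP; left; apply/eqP; congr `|_|.
by apply/matrixP => i j; rewrite !mxE ofZD; ring.
Qed.

Lemma encloses_sub m n a b (A B : 'M[F]_(m, n)) :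
  encloses a A -> encloses b B -> encloses (ball_sub m n a b) (A - B).
Proof.
move=> Aa Bb; rewrite /encloses zmx_table ofZD.
apply: le_trans (lerD Aa Bb); apply: le_trans (ler_normB _ _).
rewrite le_eqVlt; apply/orP; left; apply/eqP; congr `|_|.
by apply/matrixP => i j; rewrite !mxE ofZB; ring.
Qed.

Lemma encloses_entry m n a (A : 'M[F]_(m, n)) i j :
  encloses a A -> `|scale * A i j - ofZ (entry (mid a) i j)| <= ofZ (rad a).
Proof. by move=> Aa; have := le_trans (entry_le_norm _ i j) Aa; rewrite !mxE. Qed.

Lemma encloses_tr m n a (A : 'M[F]_(m, n)) :
  encloses a A -> encloses (ball_tr m n a) A^T.
Proof.
move=> Aa; apply: norm_le_entries; first exact: le_trans Aa.
by move=> i j; rewrite zmx_table !mxE encloses_entry.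
Qed.

Lemma encloses_up p q n a (A : 'M[F]_(p + q, n)) :
  encloses a A -> encloses (ball_up p n a) (usubmx A).
Proof.
move=> Aa; apply: norm_le_entries; first exact: le_trans Aa.
by move=> i j; rewrite zmx_table !mxE -[i : nat]/(lshift q i : nat) encloses_entry.
Qed.

Lemma encloses_down p q n a (A : 'M[F]_(p + q, n)) :
  encloses a A -> encloses (ball_down p q n a) (dsubmx A).
Proof.
move=> Aa; apply: norm_le_entries; first exact: le_trans Aa.
by move=> i j; rewrite zmx_table !mxE -[(p + i)%N]/(rshift p i : nat) encloses_entry.
Qed.

Lemma encloses_col p q n a b (A : 'M[F]_(p, n)) (B : 'M[F]_(q, n)) :
  encloses a A -> encloses b B -> encloses (ball_col p q n a b) (col_mx A B).
Proof.
move=> Aa Bb; have a0 : 0 <= ofZ (rad a) by apply: le_trans Aa.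
have [ra rb] : ofZ (rad a) <= ofZ (Z.max (rad a) (rad b)) /\
               ofZ (rad b) <= ofZ (Z.max (rad a) (rad b)).
  by split; apply: ler_ofZ; lia.
apply: norm_le_entries => [|i j]; first exact: le_trans a0 ra.
rewrite zmx_table !mxE; case: (split_ordP i) => k -> /=.
  by rewrite (le_trans _ ra) // encloses_entry.
by rewrite addKn (le_trans _ rb) // encloses_entry.
Qed.

Lemma encloses_norm m n a (A : 'M[F]_(m, n)) :
  encloses a A -> scale * `|A| <= ofZ (max_entry m n (mid a) + rad a).
Proof.
move=> Aa; rewrite -{1}(gtr0_norm scale_gt0) -mx_normZ ofZD.
rewrite -[scale *: A](subrK (zmx m n (mid a))) addrC.
by rewrite (le_trans (ler_normD _ _)) // lerD // norm_zmx.
Qed.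

(** The error splits as (sA - X)(sB) + X(sB - Y), where s is the scale and X, Y
are the midpoints. Charging the second term to the row sums of X, not to its
entries, keeps the radii from growing over a long product of matrices of row
sum below 2. *)
Lemma encloses_mul m k n a b (A : 'M[F]_(m, k)) (B : 'M[F]_(k, n)) :
  encloses a A -> encloses b B -> encloses (ball_mul m k n a b) (A *m B).
Proof.
move=> Aa Bb; rewrite /encloses; cbn [ball_mul mid rad].
set e := (X in scaledown X); set X := zmx m k (mid a); set Y := zmx k n (mid b).
set Q := zmx m n _.
have XY : `|scale *: Q - X *m Y| <= scale.
  apply: norm_le_entries => [|i j]; first exact: ltW scale_gt0.
  rewrite /Q zmx_table !mxE.
  rewrite (eq_bigr (fun l : 'I_k =>
    ofZ (entry (mid a) i l * entry (mid b) l j))); last first.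
    by move=> l _; rewrite !mxE ofZM.
  rewrite -(ofZ_sum _ (fun l => (entry (mid a) i l * entry (mid b) l j)%BZ)).
  set z := zsum _ _.
  have := scaledown_le z; have := scaledown_ge z; rewrite ler_norml; lra.
have ABXY : `|scale *: (scale *: (A *m B)) - X *m Y| <= ofZ e.
  rewrite (_ : _ - _ = (scale *: A - X) *m (scale *: B) + X *m (scale *: B - Y)).
    rewrite (le_trans (ler_normD _ _)) // ofZD lerD //.
      rewrite (le_trans (norm_mulmx _ _)) // !ofZM ofZ_nat.
      apply: ler_pM; rewrite ?mulr_ge0 ?ler_wpM2l //.
      by rewrite mx_normZ gtr0_norm ?scale_gt0 // encloses_norm.
    have r0 : 0 <= ofZ (max_row m k (mid a)) by exact/ofZ_ge0/zmax_ge0.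
    by rewrite (le_trans (norm_mulmx_rows _ r0 _)) ?ofZM ?ler_wpM2l // => i; exact: rows_zmx.
  by rewrite mulmxBl mulmxBr -!scalemxAl -!scalemxAr addrA subrK.
rewrite ofZD ofZ2.
have s0 := scale_gt0; rewrite -(ler_pM2l s0) -{1}(gtr0_norm s0) -mx_normZ.
have := scaledown_le e.
rewrite (_ : _ *: (_ - _) =
  (scale *: (scale *: (A *m B)) - X *m Y) - (scale *: Q - X *m Y)).
  have := ler_normB (scale *: (scale *: (A *m B)) - X *m Y) (scale *: Q - X *m Y).
  lra.
by rewrite scalerBr opprB addrA subrK.
Qed.

Lemma encloses_inv n X S (A : 'M[F]_n) :
  inv_ok n X S -> encloses S A ->
  A \in unitmx /\ encloses (ball_inv n X S) (invmx A).
Proof.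
move=> /andP[/Z.leb_le res_small /Z.eqb_eq X0] SA.
have s0 := scale_gt0.
pose Xm := scale^-1 *: zmx n n (mid X).
have sXm : scale *: Xm = zmx n n (mid X) by rewrite scalerA divff ?scale1r ?gt_eqF.
have XX : encloses X Xm by rewrite /encloses X0 sXm subrr normr0 ofZ0.
have := encloses_norm (encloses_sub (encloses_one n) (encloses_mul XX SA)).
rewrite -/(ball_residue n X S); set d := ball_residue n X S => dE.
have sr : scale * (ofZ d / scale) = ofZ d by rewrite mulrC divfK ?gt_eqF.
have [||uA AX] := @approx_inverse _ _ A Xm (ofZ d / scale).
- by rewrite -(ler_pM2l s0) sr.
- rewrite -(ler_pM2l s0) mulrCA sr.
  have /ler_ofZ := res_small; rewrite ofZM (ofZM 2) ofZ_nat ofZ2 -/scale -/d; lra.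
split=> //; rewrite /encloses; cbn [ball_inv mid rad].
rewrite -sXm -scalerBr mx_normZ gtr0_norm // ofZD.
apply: le_trans (ler_wpM2l (ltW s0) AX) _.
have -> : ofZ 1 = 1 := ofZ_pos 1.
rewrite -(ler_pM2l s0); apply: le_trans (scaledown_le _).
rewrite !ofZM ofZ_nat ofZ2.
have nX : scale * `|Xm| <= ofZ (max_entry n n (mid X)).
  by rewrite -{1}(gtr0_norm s0) -mx_normZ sXm norm_zmx.
have d0 : 0 <= ofZ d by apply: le_trans dE; rewrite mulr_ge0 // ltW.
rewrite (_ : scale * _ = 2 * n%:R * (scale * (ofZ d / scale)) * (scale * `|Xm|)); last by ring.
by rewrite sr ler_wpM2l // mulr_ge0 // mulr_ge0.
Qed.

End Enclosure.

(** * The affine pieces of the reduced map *)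

Section LinearStep.
Variable F : realFieldType.

Local Notation A := (ofQ F Ahat).
Local Notation B := (ofQ F Bhat).
Local Notation Qx := (ofQ F Qxhat).
Local Notation Qy := (ofQ F Qyhat).
Local Notation b := (ofQ F bhat).
Local Notation c1 := (ofQ F c1hat).
Local Notation c2 := (ofQ F c2hat).

(** The affine map Phi s on several columns at once, the constant terms being
multiplied by the row w: the same formula gives the matrix of Phi s (V = 1,
w = 0) and its constant (V = 0, w = 1). *)
Definition lin_step (s : 3.-tuple bool) n (V : 'M[F]_(3 + 3, n))
    (w : 'M[F]_(1, n)) : 'M[F]_(3 + 3, n) :=
  let y := usubmx V in
  let z := Dsign F s *m dsubmx V in
  let l := (1%:M - Dsign F s) *m dsubmx V in
  let x' := Kx F *m (A^T *m (b *m w - B *m y - z + l) - c1 *m w) in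
  let y' := Ky F *m (B^T *m (b *m w - A *m x' - z + l) - c2 *m w) in
  col_mx y' (b *m w - A *m x' - B *m y' + l).

Lemma Phi_lin_step s v : Phi s v = lin_step s v 1%:M.
Proof. by rewrite /Phi /reduced_update /lin_step !mulmx1. Qed.

Lemma lin_stepM s n k (V : 'M[F]_(3 + 3, n)) w (U : 'M[F]_(n, k)) :
  lin_step s (V *m U) (w *m U) = lin_step s V w *m U.
Proof.
rewrite /lin_step -!mul_usub_mx -!mul_dsub_mx mul_col_mx.
by rewrite !(mulmxA, =^~ mulmxBl, =^~ mulmxDl).
Qed.

Lemma lin_stepD s n (V V' : 'M[F]_(3 + 3, n)) w w' :
  lin_step s (V + V') (w + w') = lin_step s V w + lin_step s V' w'.
Proof.
pose U : 'M[F]_(n + n, n) := col_mx 1%:M 1%:M.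
have -> : V + V' = row_mx V V' *m U by rewrite mul_row_col !mulmx1.
have -> : w + w' = row_mx w w' *m U by rewrite mul_row_col !mulmx1.
rewrite lin_stepM /U.
have rowE (X : 'M[F]_(3 + 3, n + n)) : X *m U = lsubmx X + rsubmx X.
  by rewrite -{1}[X]hsubmxK mul_row_col !mulmx1.
have lE m (X : 'M[F]_(m, n + n)) : X *m col_mx 1%:M 0 = lsubmx X.
  by rewrite -{1}[X]hsubmxK mul_row_col mulmx1 mulmx0 addr0.
have rE m (X : 'M[F]_(m, n + n)) : X *m col_mx 0 1%:M = rsubmx X.
  by rewrite -{1}[X]hsubmxK mul_row_col mulmx1 mulmx0 add0r.
by rewrite rowE -lE -rE -!lin_stepM !lE !rE !row_mxKl !row_mxKr.
Qed.

Definition step_mx s : 'M[F]_(3 + 3) := lin_step s 1%:M 0.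
Definition step_cst s : 'cV[F]_(3 + 3) := lin_step s 0 1%:M.

Lemma PhiE s v : Phi s v = step_mx s *m v + step_cst s.
Proof.
by rewrite -lin_stepM mul1mx mul0mx -lin_stepD addr0 add0r Phi_lin_step.
Qed.

Definition word_mx (w : seq (3.-tuple bool)) : 'M[F]_(3 + 3) :=
  foldl (fun M s => step_mx s *m M) 1%:M w.

Lemma word_mx_rcons w s : word_mx (rcons w s) = step_mx s *m word_mx w.
Proof. by rewrite /word_mx foldl_rcons. Qed.

Lemma Phi_wordE w v : Phi_word w v = word_mx w *m v + Phi_word w 0.
Proof.
elim/last_ind: w => [|w s IH]; first by rewrite mul1mx addr0.
rewrite /Phi_word !foldl_rcons -/(Phi_word w v) -/(Phi_word w 0) !PhiE IH.
by rewrite word_mx_rcons mulmxDr mulmxA addrA.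
Qed.

Lemma Phi_word_sub w u v :
  Phi_word w u - Phi_word w v = word_mx w *m (u - v).
Proof. by rewrite (Phi_wordE w u) (Phi_wordE w v) mulmxBr opprD addrACA subrr addr0. Qed.

Lemma linear_part_Phi_word w : linear_part (Phi_word w) = word_mx w.
Proof. exact: linear_partE (Phi_wordE w). Qed.

Lemma M_perE : M_per F = word_mx W23.
Proof. exact: linear_part_Phi_word. Qed.

End LinearStep.

Section LinearStepEnclosure.
Local Open Scope Z_scope.

Definition A_ratios : seq (seq (Z * Z)) :=
  [:: [:: (5, 36); (1, 60); (25, 97)];
      [:: (1, 60); (5, 77); (5, 91)];
      [:: (25, 97); (5, 91); (11, 12)]].
Definition B_ratios : seq (seq (Z * Z)) :=
  [:: [:: (4, 61); (1, 54); (5, 83)];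
      [:: (1, 54); (13, 92); (23, 88)];
      [:: (5, 83); (23, 88); (53, 58)]].
Definition Qx_ratios : seq (seq (Z * Z)) :=
  [:: [:: (85, 93); (-1, 57); (-3, 11)];
      [:: (-1, 57); (99, 100); (-5, 86)];
      [:: (-3, 11); (-5, 86); (7, 78)]].
Definition Qy_ratios : seq (seq (Z * Z)) :=
  [:: [:: (99, 100); (-1, 51); (-3, 47)];
      [:: (-1, 51); (72, 79); (-18, 65)];
      [:: (-3, 47); (-18, 65); (4, 43)]].
Definition b_ratios : seq (seq (Z * Z)) :=
  [:: [:: (-2, 17)]; [:: (-1, 14)]; [:: (56, 73)]].
Definition c1_ratios : seq (seq (Z * Z)) :=
  [:: [:: (33, 98)]; [:: (-33, 25)]; [:: (-24, 55)]].
Definition c2_ratios : seq (seq (Z * Z)) :=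
  [:: [:: (-31, 99)]; [:: (19, 36)]; [:: (-11, 20)]].

Definition ball_A := ball_ratio 3 3 A_ratios.
Definition ball_B := ball_ratio 3 3 B_ratios.
Definition ball_b := ball_ratio 3 1 b_ratios.
Definition ball_c1 := ball_ratio 3 1 c1_ratios.
Definition ball_c2 := ball_ratio 3 1 c2_ratios.
Definition ball_Sx := ball_add 3 3 (ball_ratio 3 3 Qx_ratios)
                        (ball_mul 3 3 3 (ball_tr 3 3 ball_A) ball_A).
Definition ball_Sy := ball_add 3 3 (ball_ratio 3 3 Qy_ratios)
                        (ball_mul 3 3 3 (ball_tr 3 3 ball_B) ball_B).

(* The matrices to invert are within 1/100 of the identity. *)
Definition guess_Kx := newton 3 4 ball_Sx (ball_one 3).
Definition guess_Ky := newton 3 4 ball_Sy (ball_one 3).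
Definition ball_Kx := ball_inv 3 guess_Kx ball_Sx.
Definition ball_Ky := ball_inv 3 guess_Ky ball_Sy.

Definition ball_Dsign (s : seq bool) : ball :=
  ball_exact 3 3 (fun i j => if (i == j) && nth false s i then fixed1 else 0).

Definition ball_step (s : seq bool) n (v w : ball) : ball :=
  let y := ball_up 3 n v in
  let t := ball_down 3 3 n v in
  let z := ball_mul 3 3 n (ball_Dsign s) t in
  let l := ball_mul 3 3 n (ball_sub 3 3 (ball_one 3) (ball_Dsign s)) t in
  let bw := ball_mul 3 1 n ball_b w in
  let x' := ball_mul 3 3 n ball_Kx
    (ball_sub 3 n
      (ball_mul 3 3 n (ball_tr 3 3 ball_A)
        (ball_add 3 n (ball_sub 3 n (ball_sub 3 n bw (ball_mul 3 3 n ball_B y)) z) l))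
      (ball_mul 3 1 n ball_c1 w)) in
  let y' := ball_mul 3 3 n ball_Ky
    (ball_sub 3 n
      (ball_mul 3 3 n (ball_tr 3 3 ball_B)
        (ball_add 3 n (ball_sub 3 n (ball_sub 3 n bw (ball_mul 3 3 n ball_A x')) z) l))
      (ball_mul 3 1 n ball_c2 w)) in
  ball_col 3 3 n y'
    (ball_add 3 n (ball_sub 3 n (ball_sub 3 n bw (ball_mul 3 3 n ball_A x'))
                    (ball_mul 3 3 n ball_B y')) l).

Definition ball_step_mx s := ball_step s 6 (ball_one 6) (ball_zero 1 6).
Definition ball_step_cst s := ball_step s 1 (ball_zero 6 1) (ball_one 1).

Definition K_ok : bool := inv_ok 3 guess_Kx ball_Sx && inv_ok 3 guess_Ky ball_Sy.

Lemma K_okT : K_ok.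
Proof. by vm_compute. Qed.

Variable F : realFieldType.

(* Syntactic matching only: unification would compute in rat. *)
Local Ltac ratio_entry :=
  rewrite !mxE; cbn [nat_of_ord nth fst snd A_ratios B_ratios Qx_ratios
                     Qy_ratios b_ratios c1_ratios c2_ratios];
  split; [by []|];
  lazymatch goal with
  | |- ratr (- ?x) = _ => rewrite (rmorphN (ratr : rat -> F) x)
  | _ => idtac
  end;
  rewrite fmorph_div ?rmorph_nat ?rmorph1 ?ofZ_neg ?ofZ_pos ?mulNr;
  reflexivity.
Local Ltac ratio_mx :=
  case=> [[|[|[|?]]] ?]; [| | |by []];
  (case=> [[|[|[|?]]] ?]; [ratio_entry|ratio_entry|ratio_entry|by []]).
Local Ltac ratio_cv :=
  case=> [[|[|[|?]]] ?]; [| | |by []];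
  (case=> [[|?] ?]; [ratio_entry|by []]).

Lemma has_ratios_A : has_ratios A_ratios (ofQ F Ahat).
Proof. ratio_mx. Qed.

Lemma has_ratios_B : has_ratios B_ratios (ofQ F Bhat).
Proof. ratio_mx. Qed.

Lemma has_ratios_Qx : has_ratios Qx_ratios (ofQ F Qxhat).
Proof. ratio_mx. Qed.

Lemma has_ratios_Qy : has_ratios Qy_ratios (ofQ F Qyhat).
Proof. ratio_mx. Qed.

Lemma has_ratios_b : has_ratios b_ratios (ofQ F bhat).
Proof. ratio_cv. Qed.

Lemma has_ratios_c1 : has_ratios c1_ratios (ofQ F c1hat).
Proof. ratio_cv. Qed.

Lemma has_ratios_c2 : has_ratios c2_ratios (ofQ F c2hat).
Proof. ratio_cv. Qed.

Lemma encloses_A : encloses ball_A (ofQ F Ahat).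
Proof. exact: encloses_ratio has_ratios_A. Qed.

Lemma encloses_B : encloses ball_B (ofQ F Bhat).
Proof. exact: encloses_ratio has_ratios_B. Qed.

Lemma encloses_b : encloses ball_b (ofQ F bhat).
Proof. exact: encloses_ratio has_ratios_b. Qed.

Lemma encloses_c1 : encloses ball_c1 (ofQ F c1hat).
Proof. exact: encloses_ratio has_ratios_c1. Qed.

Lemma encloses_c2 : encloses ball_c2 (ofQ F c2hat).
Proof. exact: encloses_ratio has_ratios_c2. Qed.

Local Open Scope ring_scope.

Lemma encloses_Kx :
  ofQ F Qxhat + (ofQ F Ahat)^T *m ofQ F Ahat \in unitmx /\
  encloses ball_Kx (Kx F).
Proof.
have /andP[xK _] := K_okT; apply: encloses_inv xK _.
apply: encloses_add (encloses_ratio has_ratios_Qx) _.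
exact: encloses_mul (encloses_tr encloses_A) encloses_A.
Qed.

Lemma encloses_Ky :
  ofQ F Qyhat + (ofQ F Bhat)^T *m ofQ F Bhat \in unitmx /\
  encloses ball_Ky (Ky F).
Proof.
have /andP[_ yK] := K_okT; apply: encloses_inv yK _.
apply: encloses_add (encloses_ratio has_ratios_Qy) _.
exact: encloses_mul (encloses_tr encloses_B) encloses_B.
Qed.

Lemma encloses_Dsign (s : 3.-tuple bool) : encloses (ball_Dsign s) (Dsign F s).
Proof.
apply: encloses_exact => i j; rewrite !mxE (tnth_nth false) -val_eqE.
by case: eqP => [->|_]; case: nth; rewrite /= ?mulr1 ?mulr0 ?ofZ0.
Qed.

Lemma encloses_step (s : 3.-tuple bool) n v w V (W : 'M[F]_(1, n)) :
  encloses v V -> encloses w W -> encloses (ball_step s n v w) (lin_step s V W).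
Proof.
move=> vV wW; have [[_ KxE] [_ KyE]] := (encloses_Kx, encloses_Ky).
have yE := encloses_up vV; have tE := encloses_down vV.
have DE := encloses_Dsign s.
have zE := encloses_mul DE tE.
have lE := encloses_mul (encloses_sub (encloses_one F 3) DE) tE.
have bE := encloses_mul encloses_b wW.
have AE := encloses_A; have BE := encloses_B.
have ATE := encloses_tr AE; have BTE := encloses_tr BE.
have xE := encloses_mul KxE (encloses_sub (encloses_mul ATE
  (encloses_add (encloses_sub (encloses_sub bE (encloses_mul BE yE)) zE) lE))
  (encloses_mul encloses_c1 wW)).
have y'E := encloses_mul KyE (encloses_sub (encloses_mul BTE
  (encloses_add (encloses_sub (encloses_sub bE (encloses_mul AE xE)) zE) lE))
  (encloses_mul encloses_c2 wW)).
exact: encloses_col y'E (encloses_add (encloses_sub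
  (encloses_sub bE (encloses_mul AE xE)) (encloses_mul BE y'E)) lE).
Qed.

Lemma encloses_step_mx (s : 3.-tuple bool) :
  encloses (ball_step_mx s) (step_mx F s).
Proof. exact: encloses_step (encloses_one F 6) (encloses_zero F 1 6). Qed.

Lemma encloses_step_cst (s : 3.-tuple bool) :
  encloses (ball_step_cst s) (step_cst F s).
Proof. exact: encloses_step (encloses_zero F 6 1) (encloses_one F 1). Qed.

End LinearStepEnclosure.

(** * The certificate *)

Section Certificate.
Local Open Scope Z_scope.

Definition letters : seq (seq bool) := undup [seq tval s | s <- W23].

(* The affine pieces of the distinct letters, computed once. *)
Definition step_table : seq (ball * ball) :=
  [seq (ball_step_mx s, ball_step_cst s) | s <- letters].

Definition step_of (s : seq bool) : ball * ball :=
  nth (ball_zero 6 6, ball_zero 6 1) step_table (index s letters).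

Definition ball_Phi (s : seq bool) (v : ball) : ball :=
  ball_add 6 1 (ball_mul 6 6 1 (step_of s).1 v) (step_of s).2.

Definition ball_word_mx (w : seq (seq bool)) : ball :=
  foldl (fun M s => ball_mul 6 6 6 (step_of s).1 M) (ball_one 6) w.

Definition ball_word_cst (w : seq (seq bool)) : ball :=
  foldl (fun v s => ball_Phi s v) (ball_zero 6 1) w.

Definition word_bits : seq (seq bool) := [seq tval s | s <- W23].

Definition ball_M_per : ball := ball_word_mx word_bits.

Definition ball_IM_per : ball := ball_sub 6 6 (ball_one 6) ball_M_per.

(* From the start 1, Newton's iteration yields the partial sums of the Neumann
series with 2 ^ k terms; M_per has spectral radius about 0.77. *)
Definition guess_IM_per : ball := newton 6 7 ball_IM_per (ball_one 6).

Definition ball_vhat0 : ball :=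
  ball_mul 6 6 1 (ball_inv 6 guess_IM_per ball_IM_per) (ball_word_cst word_bits).

Definition separated (s : seq bool) (v : ball) : bool :=
  all (fun i => let t := entry (mid v) (3 + i) 0 in
         (fixed1 + 250 * rad v <? 250 * (if nth false s i then t else - t))%BZ)
      (iota 0 3).

Fixpoint orbit_ok (w : seq (seq bool)) (v : ball) : bool :=
  if w is s :: w' then separated s v && orbit_ok w' (ball_Phi s v) else true.

Definition row_sums_le m n (p q : Z) (a : ball) : bool :=
  (q * (max_row m n (mid a) + Z.of_nat n * rad a) <=? p * fixed1)%BZ.

Definition ball_sqr (a : ball) : ball := ball_mul 6 6 6 a a.

Definition kkt_letter : 3.-tuple bool := [tuple false; false; true].

Definition ball_IN_kkt : ball :=
  ball_sub 6 6 (ball_one 6) (step_of kkt_letter).1.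

(* The entries of (1 - N)^-1 rounded to eighths, where N is the step matrix of
the letter (-,-,+). Here N has spectral radius above 1, so that Newton's
iteration cannot start from 1. *)
Definition kkt_start : ball :=
  let c := [:: [:: 8; 0; 2; 0; 2; 1]; [:: 0; 8; 0; -2; 8; 1];
              [:: 0; 0; 8; -6; 27; -1]; [:: 2; 8; 26; 8; 0; 22];
              [:: -1; -2; -6; 0; 8; 21]; [:: 0; 0; 0; -22; -21; 9]] in
  Ball (table 6 6 (fun i j => entry c i j * (fixed1 / 8))%BZ) 0.

Definition guess_IN_kkt : ball := newton 6 4 ball_IN_kkt kkt_start.

Definition ball_kkt : ball :=
  ball_mul 6 6 1 (ball_inv 6 guess_IN_kkt ball_IN_kkt) (step_of kkt_letter).2.

Definition certificate : bool :=
  [&& all (fun a => row_sums_le 6 6 2 1 a.1) step_table,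
      inv_ok 6 guess_IM_per ball_IM_per,
      orbit_ok word_bits ball_vhat0,
      row_sums_le 6 6 1 5 (ball_sqr (ball_sqr (ball_sqr (ball_sqr ball_M_per)))) &
      inv_ok 6 guess_IN_kkt ball_IN_kkt && separated kkt_letter ball_kkt].

Lemma certificateT : certificate.
Proof. by vm_compute. Qed.

End Certificate.

Section CertificateSound.
Variable F : realFieldType.

Definition separates (s : 3.-tuple bool) (t : 'cV[F]_3) : Prop :=
  forall i, if tnth s i then 1 / 250 < t i 0 else t i 0 < - (1 / 250).

Lemma separatedP (s : 3.-tuple bool) v (V : 'cV[F]_(3 + 3)) :
  separated s v -> encloses v V -> separates s (dsubmx V).
Proof.
move=> /allP sv vV i.
have := encloses_entry (rshift 3 i) 0 vV; rewrite mxE /= (tnth_nth false).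
have := sv i; rewrite mem_iota => /(_ (ltn_ord i)); cbv beta zeta.
move: (V _ _) (entry _ _ _) => x t; have s0 := scale_gt0 F; move=> sep.
rewrite ler_norml => /andP[lo hi]; move: sep => /Z.ltb_lt/(@ltr_ofZ F).
have z250 : ofZ F 250 = 250 := ofZ_pos F 250.
rewrite ofZD [ofZ F (250 * rad v)]ofZM [ofZ F (250 * (if _ then _ else _))]ofZM z250.
rewrite -/(scale F).
by case: (nth false s i); rewrite ?ofZN => sep; rewrite -(ltr_pM2l s0); lra.
Qed.

Lemma row_sums_leP m k n p q a (A : 'M[F]_(m, k)) (B : 'M[F]_(k, n)) :
  row_sums_le m k (Zpos p) (Zpos q) a -> encloses a A ->
  `|A *m B| <= (Pos.to_nat p)%:R / (Pos.to_nat q)%:R * `|B|.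
Proof.
move=> /Z.leb_le/(@ler_ofZ F); rewrite ofZM [ofZ F (_ * fixed1)]ofZM.
rewrite -/(scale F) ofZD ofZM ofZ_nat.
rewrite !ofZ_pos => rows aA; have s0 := scale_gt0 F.
have q0 : 0 < (Pos.to_nat q)%:R :> F by rewrite -ofZ_pos ofZ_gt0.
apply: norm_mulmx_rows => [|i]; first by rewrite divr_ge0.
rewrite ler_pdivlMr // -(ler_pM2l s0) [scale F * _%:R]mulrC; apply: le_trans rows.
rewrite mulrCA mulrA mulrC ler_wpM2l ?(ltW q0) // mulr_suml.
apply: le_trans (_ : \sum_j (`|zmx F m k (mid a) i j| + ofZ F (rad a)) <= _).
  apply: ler_sum => j _; rewrite mulrC -{1}(gtr0_norm s0) -normrM.
  have := encloses_entry i j aA; rewrite distrC => aij.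
  by rewrite -lerBlDl (le_trans (lerB_dist _ _)) // distrC mxE.
rewrite big_split /= lerD ?rows_zmx // sumr_const card_ord.
by rewrite mulr_natl.
Qed.

End CertificateSound.

Section CertificateConsequences.
Variable F : realFieldType.
Implicit Types s : 3.-tuple bool.

Lemma step_ofE s : s \in W23 ->
  (index (tval s) letters < size step_table)%N /\
  step_of s = (ball_step_mx s, ball_step_cst s).
Proof.
move=> sW; have sl : tval s \in letters by rewrite mem_undup map_f.
have si : (index (tval s) letters < size letters)%N by rewrite index_mem.
split; first by rewrite size_map.
by rewrite /step_of (nth_map [::]) // nth_index.
Qed.

Lemma encloses_step_of s : s \in W23 ->
  encloses (step_of s).1 (step_mx F s) /\ encloses (step_of s).2 (step_cst F s).
Proof.
move=> /step_ofE[_ ->].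
by split; [exact: encloses_step_mx | exact: encloses_step_cst].
Qed.

Lemma encloses_Phi s v (V : 'cV[F]_(3 + 3)) :
  s \in W23 -> encloses v V -> encloses (ball_Phi s v) (Phi s V).
Proof.
move=> /encloses_step_of[sN sd] vV; rewrite PhiE.
exact: encloses_add (encloses_mul sN vV) sd.
Qed.

Lemma encloses_word_mx w : {subset w <= W23} ->
  encloses (ball_word_mx [seq tval s | s <- w]) (word_mx F w).
Proof.
elim/last_ind: w => [_|w s IH sub]; first exact: encloses_one.
rewrite map_rcons /ball_word_mx foldl_rcons word_mx_rcons.
apply: (@encloses_mul F 6 6 6); last first.
  by apply: IH => u uw; apply: sub; rewrite mem_rcons inE uw orbT.
by case: (@encloses_step_of s) => //; apply: sub; rewrite mem_rcons inE eqxx.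
Qed.

Lemma encloses_word_cst w : {subset w <= W23} ->
  encloses (ball_word_cst [seq tval s | s <- w]) (Phi_word w (0 : 'cV[F]_(3 + 3))).
Proof.
elim/last_ind: w => [_|w s IH sub]; first exact: encloses_zero.
rewrite map_rcons /ball_word_cst /Phi_word !foldl_rcons.
apply: encloses_Phi; first by apply: sub; rewrite mem_rcons inE eqxx.
by apply: IH => u uw; apply: sub; rewrite mem_rcons inE uw orbT.
Qed.

Lemma step_mx_norm s n (V : 'M[F]_(3 + 3, n)) :
  s \in W23 -> `|step_mx F s *m V| <= 2 * `|V|.
Proof.
move=> sW; have [idx _] := step_ofE sW.
have /andP[/(all_nthP (ball_zero 6 6, ball_zero 6 1))/(_ _ idx) rows _] := certificateT.
have [sN _] := encloses_step_of sW.
by have := row_sums_leP V rows sN; rewrite -[Pos.to_nat 2]/2%N -[Pos.to_nat 1]/1%N divr1.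
Qed.

Lemma encloses_M_per : encloses ball_M_per (M_per F).
Proof. by rewrite M_perE; exact: encloses_word_mx. Qed.

(** In the maximum norm M_per expands some vectors; only a power of it contracts. *)
Lemma M_per_pow16_norm n (V : 'M[F]_(3 + 3, n)) :
  `|(M_per F ^+ 16) *m V| <= 1 / 5 * `|V|.
Proof.
have /and5P[_ _ _ rows _] := certificateT.
rewrite (_ : M_per F ^+ 16 = (((M_per F ^+ 2) ^+ 2) ^+ 2) ^+ 2); last by rewrite -!exprM.
have enc_sqr a (A : 'M[F]_(3 + 3)) :
    encloses a A -> encloses (ball_sqr a) (A ^+ 2).
  by move=> aA; rewrite expr2; exact: (@encloses_mul F 6 6 6).
have := row_sums_leP V rows
  (enc_sqr _ _ (enc_sqr _ _ (enc_sqr _ _ (enc_sqr _ _ encloses_M_per)))).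
by rewrite -[Pos.to_nat 5]/5%N -[Pos.to_nat 1]/1%N.
Qed.

Lemma IM_per_enclosure :
  1%:M - M_per F \in unitmx /\
  encloses (ball_inv 6 guess_IM_per ball_IM_per) (invmx (1%:M - M_per F)).
Proof.
have /and5P[_ ok _ _ _] := certificateT.
apply: encloses_inv ok _.
exact: (@encloses_sub F 6 6) (encloses_one F 6) encloses_M_per.
Qed.

Lemma vhat0_fixed : Phi_per (vhat0 F) = vhat0 F.
Proof.
have [u _] := IM_per_enclosure.
have : (1%:M - M_per F) *m vhat0 F = c_per F by rewrite mulmxA mulmxV ?mul1mx.
by rewrite mulmxBl mul1mx Phi_perE => <-; rewrite addrC subrK.
Qed.

Lemma orbit_ok_separates w v (V : 'cV[F]_(3 + 3)) :
  {subset w <= W23} -> orbit_ok [seq tval s | s <- w] v -> encloses v V ->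
  forall j, (j < size w)%N ->
    separates (nth [tuple false; false; false] w j)
              (dsubmx (Phi_word (take j w) V)).
Proof.
elim: w v V => //= s w IH v V sub /andP[sv ok] vV [_|j jw].
  exact: separatedP sv vV.
apply: IH ok _ j jw; first by move=> u uw; apply: sub; rewrite inE uw orbT.
by apply: encloses_Phi vV; apply: sub; rewrite inE eqxx.
Qed.

Lemma that_separates j : (j < 23)%N -> separates (sigma j) (that F j).
Proof.
move=> j23; have /and5P[_ _ ok _ _] := certificateT.
apply: orbit_ok_separates ok _ _ _ => //.
apply: (@encloses_mul F 6 6 1); first by case: IM_per_enclosure.
exact: encloses_word_cst.
Qed.

(** Where t has signs s the reduced map is Phi s, so this v is one of its fixed
points: the source of the KKT point. *)
Lemma exists_fixed_point :
  exists v : 'cV[F]_(3 + 3), Phi kkt_letter v = v /\ strict_sign kkt_letter (dsubmx v).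
Proof.
have /and5P[_ _ _ _ /andP[ok sep]] := certificateT.
have kW : kkt_letter \in W23 by [].
have [kN kd] := encloses_step_of kW.
have [|u iE] := encloses_inv (A := 1%:M - step_mx F kkt_letter) ok.
  exact: (@encloses_sub F 6 6) (encloses_one F 6) kN.
pose v := invmx (1%:M - step_mx F kkt_letter) *m step_cst F kkt_letter.
exists v; split.
  have : (1%:M - step_mx F kkt_letter) *m v = step_cst F kkt_letter.
    by rewrite mulmxA mulmxV ?mul1mx.
  by rewrite mulmxBl mul1mx PhiE => <-; rewrite addrC subrK.
have vE : encloses ball_kkt v by exact: (@encloses_mul F 6 6 1) iE kd.
have vs := @separatedP F kkt_letter _ _ sep vE.
by move=> i; have := vs i; case: (tnth _ _); lra.
Qed.

End CertificateConsequences.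

(** * Definiteness of the data *)

Section Definiteness.
Variable F : realFieldType.

Lemma dotE n (u v : 'cV[F]_n) : dot u v = \sum_i u i 0 * v i 0.
Proof. by rewrite /dot mxE; apply: eq_bigr => i _; rewrite mxE. Qed.

Lemma big_ord3 (f : 'I_3 -> F) : \sum_i f i = f 0 + f 1 + f 2.
Proof.
rewrite !big_ord_recl big_ord0 addr0 addrA.
by congr (f _ + f _ + f _); apply: val_inj.
Qed.

(** Completing the square twice. The last hypothesis is on a times the
determinant. *)
Lemma ternary_form_gt0 (a b c d e f x y z : F) :
  0 < a -> 0 < a * d - b ^+ 2 ->
  0 < (a * d - b ^+ 2) * (a * f - c ^+ 2) - (a * e - b * c) ^+ 2 ->
  [|| x != 0, y != 0 | z != 0] ->
  0 < a * x ^+ 2 + 2 * b * x * y + 2 * c * x * z + d * y ^+ 2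
      + 2 * e * y * z + f * z ^+ 2.
Proof.
move=> a0; set m := a * d - _; set k := a * e - _; set n := a * f - _ => m0.
set D := _ - _ => D0 nz.
set q := (X in 0 < X).
have eq_q : a * m * q = m * (a * x + b * y + c * z) ^+ 2 + (m * y + k * z) ^+ 2
                  + D * z ^+ 2.
  by rewrite /q /D /m /k /n; ring.
have am : 0 < a * m by rewrite mulr_gt0.
rewrite -(pmulr_rgt0 _ am) eq_q.
have h1 : 0 <= m * (a * x + b * y + c * z) ^+ 2 by rewrite mulr_ge0 ?sqr_ge0 // ltW.
have h2 := sqr_ge0 (m * y + k * z).
have h3 : 0 <= D * z ^+ 2 by rewrite mulr_ge0 ?sqr_ge0 // ltW.
have [z0|z0] := eqVneq z 0; last first.
  have : 0 < D * z ^+ 2 by rewrite mulr_gt0 // exprn_even_gt0.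
  lra.
have [y0|y0] := eqVneq y 0; last first.
  have : 0 < (m * y + k * z) ^+ 2.
    by rewrite z0 mulr0 addr0 exprn_even_gt0 //= mulf_neq0 // gt_eqF.
  lra.
move: nz; rewrite z0 y0 !eqxx !orbF => x0.
have : 0 < m * (a * x + b * y + c * z) ^+ 2.
  by rewrite mulr_gt0 // z0 y0 !mulr0 !addr0 exprn_even_gt0 //= mulf_neq0 // gt_eqF.
rewrite z0 y0; lra.
Qed.

Lemma posdef3 (Q : 'M[F]_3) :
  Q^T = Q -> 0 < Q 0 0 -> 0 < Q 0 0 * Q 1 1 - Q 0 1 ^+ 2 ->
  0 < (Q 0 0 * Q 1 1 - Q 0 1 ^+ 2) * (Q 0 0 * Q 2 2 - Q 0 2 ^+ 2)
      - (Q 0 0 * Q 1 2 - Q 0 1 * Q 0 2) ^+ 2 ->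
  posdef Q.
Proof.
move=> sym a0 m0 D0; split=> // u u0.
have symE i j : Q j i = Q i j by rewrite -{1}sym mxE.
have nz : [|| u 0 0 != 0, u 1 0 != 0 | u 2 0 != 0].
  apply: contraNT u0; rewrite !negb_or !negbK => /and3P[/eqP h0 /eqP h1 /eqP h2].
  apply/eqP/colP => -[[|[|[|//]]] lt3]; rewrite mxE;
    [rewrite -h0|rewrite -h1|rewrite -h2]; by congr (u _ _); apply: val_inj.
have := ternary_form_gt0 a0 m0 D0 nz.
rewrite dotE big_ord3 !mxE !big_ord3 (symE 0 1) (symE 0 2) (symE 1 2).
set X := (X in 0 < X -> _); set Y := (X in _ -> 0 < X).
suff -> : X = Y by [].
rewrite /X /Y; ring.
Qed.

End Definiteness.
Lemma posdef_unit (F : realFieldType) n (Q : 'M[F]_n) : posdef Q -> Q \in unitmx.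
Proof.
move=> [sym pos]; rewrite -row_free_unit -kermx_eq0; apply/rowV0P => u /sub_kermxP uQ.
apply/eqP; apply: contraT => u0.
have /pos : u^T != 0 by rewrite -trmx0 (inj_eq trmx_inj).
by rewrite /dot trmxK mulmxA uQ mul0mx mxE ltxx.
Qed.

Section DataDefiniteness.
Variable F : realFieldType.

(** Stated on numerators and denominators, so that the hypotheses become
inequalities between explicit fractions. *)
Lemma posdef_ratios (q : seq (seq (Z * Z))) (Q : 'M[F]_3)
    (r := fun i j => let x := nth (0, 1)%BZ (nth [::] q i) j in ofZ F x.1 / ofZ F x.2) :
  has_ratios q Q ->
  r 1%N 0%N = r 0%N 1%N -> r 2%N 0%N = r 0%N 2%N -> r 2%N 1%N = r 1%N 2%N ->
  0 < r 0%N 0%N -> 0 < r 0%N 0%N * r 1%N 1%N - r 0%N 1%N ^+ 2 ->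
  0 < (r 0%N 0%N * r 1%N 1%N - r 0%N 1%N ^+ 2)
      * (r 0%N 0%N * r 2%N 2%N - r 0%N 2%N ^+ 2)
      - (r 0%N 0%N * r 1%N 2%N - r 0%N 1%N * r 0%N 2%N) ^+ 2 ->
  posdef Q.
Proof.
move=> Qq s10 s20 s21 a0 m0 D0.
have QE (i j : 'I_3) : Q i j = r i j by case: (Qq i j).
apply: posdef3; rewrite ?QE //.
by apply/matrixP => -[[|[|[|//]]] ?] [[|[|[|//]]] ?]; rewrite mxE !QE.
Qed.

Local Ltac posdef_data H :=
  apply: (posdef_ratios (H F));
  cbn [nth fst snd A_ratios B_ratios Qx_ratios Qy_ratios];
  rewrite ?ofZ_neg ?ofZ_pos; cbv [Pos.to_nat Pos.iter_op Nat.add]; first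
  [reflexivity | lra].

Lemma posdef_A : posdef (ofQ F Ahat).
Proof. posdef_data has_ratios_A. Qed.

Lemma posdef_B : posdef (ofQ F Bhat).
Proof. posdef_data has_ratios_B. Qed.

Lemma posdef_Qx : posdef (ofQ F Qxhat).
Proof. posdef_data has_ratios_Qx. Qed.

Lemma posdef_Qy : posdef (ofQ F Qyhat).
Proof. posdef_data has_ratios_Qy. Qed.

End DataDefiniteness.

Lemma det_ofQ_unit n (Q : 'M[rat]_n) : ofQ rat Q \in unitmx -> \det Q != 0.
Proof. by rewrite unitmxE det_map_mx unitfE fmorph_eq0. Qed.

(** * ADMM in reduced coordinates and KKT points *)

Section ReducedDynamics.
Variable F : realFieldType.

Lemma pos_neg_part n (t : 'cV[F]_n) : pos_part t + neg_part t = t.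
Proof. by apply/colP => i; rewrite !mxE addr_max_min addr0. Qed.

Lemma pos_part_sign (s : 3.-tuple bool) (t : 'cV[F]_3) :
  strict_sign s t -> pos_part t = Dsign F s *m t.
Proof.
move=> st; apply/colP => i; rewrite mul_diag_mx !mxE; have := st i.
by case: (tnth s i) => ti; rewrite ?(mul1r, mul0r); [rewrite max_l | rewrite max_r]; rewrite // ltW.
Qed.

Lemma neg_part_sign (s : 3.-tuple bool) (t : 'cV[F]_3) :
  strict_sign s t -> neg_part t = (1%:M - Dsign F s) *m t.
Proof.
move=> /pos_part_sign st.
by rewrite mulmxBl mul1mx -st -{2}[t]pos_neg_part addrC addKr.
Qed.

Lemma reduced_map_sign s (v : 'cV[F]_(3 + 3)) :
  strict_sign s (dsubmx v) -> reduced_map v = Phi s v.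
Proof.
by move=> sv; rewrite /reduced_map (pos_part_sign sv) (neg_part_sign sv).
Qed.

Lemma reduced_state_reconstruct x (v : 'cV[F]_(3 + 3)) :
  reduced_state (reconstruct x v) = v.
Proof. by rewrite /= pos_neg_part vsubmxK. Qed.

Lemma admm_step_reconstruct x (v : 'cV[F]_(3 + 3)) :
  admm_step (reconstruct x v) =
  reconstruct (x_update (usubmx v) (pos_part (dsubmx v)) (neg_part (dsubmx v)))
              (reduced_map v).
Proof.
rewrite /admm_step /reconstruct /reduced_map /reduced_update.
rewrite col_mxKu col_mxKd; congr (_, _, _, _).
set x' := x_update _ _ _; set y' := y_update _ _ _.
set l := neg_part _; have := pos_neg_part (t_update x' y' l).
move: (pos_part _) (neg_part (t_update _ _ _)) => p q /(canRL (addKr _)) ->.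
by apply/colP => i; rewrite !mxE; ring.
Qed.

Lemma reduced_state_admm_seq x (v : 'cV[F]_(3 + 3)) k :
  reduced_state (admm_seq (reconstruct x v) k) = reduced_seq v k.
Proof.
suff [x' ->] : exists x', admm_seq (reconstruct x v) k = reconstruct x' (reduced_seq v k).
  exact: reduced_state_reconstruct.
elim: k => [|k [x' IH]]; first by exists x.
rewrite /admm_seq /reduced_seq !iterS -/(admm_seq _ k) -/(reduced_seq _ k) IH.
by rewrite admm_step_reconstruct; eexists.
Qed.

End ReducedDynamics.

Section KKT.
Variable F : realFieldType.

Local Notation A := (ofQ F Ahat).
Local Notation B := (ofQ F Bhat).
Local Notation Qx := (ofQ F Qxhat).
Local Notation Qy := (ofQ F Qyhat).
Local Notation b := (ofQ F bhat).
Local Notation c1 := (ofQ F c1hat).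
Local Notation c2 := (ofQ F c2hat).

Lemma normal_coneP n (z l : 'cV[F]_n) :
  nonneg_orthant z ->
  normal_cone (@nonneg_orthant F n) z l <->
  (forall i, l i 0 <= 0 /\ l i 0 * z i 0 = 0).
Proof.
move=> z0; split=> [[_ zl] i|zl].
  have li : l i 0 <= 0.
    have := zl (z + delta_mx i 0); rewrite dotE addrAC subrr add0r.
    rewrite (bigD1 i) //= big1 => [|j ji]; rewrite !mxE ?eqxx /= ?(negbTE ji) ?mulr0 //.
    rewrite mulr1 addr0; apply=> j; rewrite !mxE.
    by apply: addr_ge0; [exact: z0 | exact: ler0n].
  have zi : 0 <= z i 0 := z0 i.
  split=> //; apply/eqP; rewrite eq_le mulr_le0_ge0 //=.
  have := zl (z - z i 0 *: delta_mx i 0); rewrite dotE addrAC subrr add0r.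
  rewrite (bigD1 i) //= big1 => [|j ji];
    rewrite !mxE ?eqxx /= ?(negbTE ji) ?mulr0 ?oppr0 ?mulr0 //.
  rewrite mulr1 addr0 mulrN oppr_le0; apply=> j; rewrite !mxE.
  have [->|ji] := eqVneq j i; first by rewrite mulr1 subrr.
  by rewrite /= mulr0 subr0 z0.
split=> // w w0; rewrite dotE sumr_le0 // => i _; have [li liz] := zl i.
by rewrite !mxE mulrBr liz subr0 mulr_le0_ge0 //; exact: w0.
Qed.

Lemma pos_part_complementary n (z l : 'cV[F]_n) :
  nonneg_orthant z -> normal_cone (@nonneg_orthant F n) z l ->
  pos_part (z + l) = z.
Proof.
move=> z0 /(normal_coneP l z0) zl; apply/colP => i; rewrite !mxE.
have [li /eqP] := zl i; have zi : 0 <= z i 0 := z0 i.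
rewrite mulf_eq0 => /orP[]/eqP ->; first by rewrite addr0 max_l.
by rewrite add0r max_r.
Qed.

Lemma complementary_parts n (t : 'cV[F]_n) :
  nonneg_orthant (pos_part t) /\
  normal_cone (@nonneg_orthant F n) (pos_part t) (neg_part t).
Proof.
have p0 : nonneg_orthant (pos_part t) by move=> i; rewrite mxE le_max lexx orbT.
split=> //; apply/(normal_coneP _ p0) => i; rewrite !mxE ge_min lexx orbT; split=> //.
by case: leP => _; rewrite ?mulr0 ?mul0r.
Qed.

Lemma x_updateE y z l :
  (Qx + A^T *m A) *m x_update y z l = A^T *m (b - B *m y - z + l) - c1.
Proof. by have [u _] := encloses_Kx F; rewrite mulKVmx. Qed.

Lemma y_updateE x z l :
  (Qy + B^T *m B) *m y_update x z l = B^T *m (b - A *m x - z + l) - c2.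
Proof. by have [u _] := encloses_Ky F; rewrite mulKVmx. Qed.

(** The steps of the method are exact minimizations, whose optimality conditions
a KKT point already satisfies. *)
Lemma KKT_fixed (w : state F) : is_KKT w -> admm_step w = w.
Proof.
case: w => [[[x y] z] l] [Ax By feas z0 zl].
have x'E : x_update y z l = x.
  have [u _] := encloses_Kx F; apply: (can_inj (mulKmx u)); rewrite x_updateE.
  rewrite (_ : b - _ - _ = A *m x) -?feas.
    by rewrite mulmxDr Ax mulmxDl mulmxA addrA addrK addrC.
  by apply/colP => i; rewrite !mxE; ring.
have y'E : y_update x z l = y.
  have [u _] := encloses_Ky F; apply: (can_inj (mulKmx u)); rewrite y_updateE.
  rewrite (_ : b - _ - _ = B *m y) -?feas.
    by rewrite mulmxDr By mulmxDl mulmxA addrA addrK addrC.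
  by apply/colP => i; rewrite !mxE; ring.
rewrite /admm_step x'E y'E.
have tE : t_update x y l = z + l.
  by rewrite /t_update -feas; apply/colP => i; rewrite !mxE; ring.
by rewrite tE pos_part_complementary // feas subrr subr0.
Qed.

(** Stationarity in x and y is the optimality of the two minimizations, at a state
which they leave unchanged; t = z + lambda yields feasibility. *)
Lemma fixed_KKT (v : 'cV[F]_(3 + 3)) (y := usubmx v) (z := pos_part (dsubmx v))
    (l := neg_part (dsubmx v)) :
  reduced_map v = v -> is_KKT (x_update y z l, y, z, l).
Proof.
rewrite -[RHS]vsubmxK -(pos_neg_part (dsubmx v)) -/y -/z -/l.
move=> /eq_col_mx[]; rewrite -/y -/z -/l; set x := x_update _ _ _ => yE tE.
have feas : A *m x + B *m y + z = b.
  move: tE; rewrite yE => /colP tE; apply/colP => i; have := tE i.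
  by rewrite !mxE; lra.
have solve (a m t c : 'cV[F]_3) : a + m = m + t - c -> t = a + c.
  by move=> /colP E; apply/colP => i; have := E i; rewrite !mxE; lra.
have [z0 zl] := complementary_parts (dsubmx v); split=> //.
  have := x_updateE y z l; rewrite -/x (_ : b - _ - _ = A *m x); last first.
    by rewrite -feas; apply/colP => i; rewrite !mxE; ring.
  by rewrite mulmxDr mulmxDl mulmxA => /solve.
have := y_updateE x z l; rewrite yE (_ : b - _ - _ = B *m y); last first.
  by rewrite -feas; apply/colP => i; rewrite !mxE; ring.
by rewrite mulmxDr mulmxDl mulmxA => /solve.
Qed.

(** Pairing the differences of two KKT points gives
dx^T Qx dx + dy^T Qy dy + dl^T dz = 0, whose last term is nonnegative by
monotonicity of the normal cone. *)
Lemma KKT_unique (w1 w2 : state F) : is_KKT w1 -> is_KKT w2 -> w1 = w2.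
Proof.
case: w1 => [[[x1 y1] z1] l1] [Ax1 By1 feas1 _ [z10 zl1]].
case: w2 => [[[x2 y2] z2] l2] [Ax2 By2 feas2 _ [z20 zl2]].
have [_ posx] := posdef_Qx F; have [_ posy] := posdef_Qy F.
have dotDr n (u v w : 'cV[F]_n) : dot u (v + w) = dot u v + dot u w.
  by rewrite /dot mulmxDr mxE.
have dotNr n (u v : 'cV[F]_n) : dot u (- v) = - dot u v.
  by rewrite /dot mulmxN mxE.
have dot_tr m n (M : 'M[F]_(m, n)) u v : dot u (M *m v) = dot (M^T *m u) v.
  by rewrite /dot trmx_mul trmxK mulmxA.
have dotC n (u v : 'cV[F]_n) : dot u v = dot v u.
  by rewrite !dotE; apply: eq_bigr => i _; rewrite mulrC.
have dx : A^T *m (l1 - l2) = Qx *m (x1 - x2).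
  by rewrite !mulmxBr Ax1 Ax2 opprD addrACA subrr addr0.
have dy : B^T *m (l1 - l2) = Qy *m (y1 - y2).
  by rewrite !mulmxBr By1 By2 opprD addrACA subrr addr0.
have sum0 : dot (x1 - x2) (Qx *m (x1 - x2)) + dot (y1 - y2) (Qy *m (y1 - y2))
            + dot (l1 - l2) (z1 - z2) = 0.
  rewrite -dx -dy ![dot _ (_^T *m _)]dotC -!dot_tr -!dotDr !mulmxBr.
  rewrite (_ : A *m x1 - _ + _ + _ = (A *m x1 + B *m y1 + z1) - (A *m x2 + B *m y2 + z2)).
    by rewrite feas1 feas2 subrr /dot mulmx0 mxE.
  by apply/colP => i; rewrite !mxE; ring.
have mono : 0 <= dot (l1 - l2) (z1 - z2).
  have := zl1 _ z20; have := zl2 _ z10.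
  have -> : dot (l1 - l2) (z1 - z2) = - dot l1 (z2 - z1) - dot l2 (z1 - z2).
    by rewrite dotC dotDr dotNr ![dot (z1 - z2) _]dotC -(opprB z1 z2) dotNr opprK.
  lra.
have ge0 n (Q : 'M[F]_n) u : (forall u, u != 0 -> 0 < dot u (Q *m u)) -> 0 <= dot u (Q *m u).
  move=> pos; have [->|/pos/ltW//] := eqVneq u 0.
  by rewrite /dot mulmx0 mulmx0 mxE.
have x0 := ge0 _ _ (x1 - x2) posx; have y0 := ge0 _ _ (y1 - y2) posy.
have ex : x1 = x2.
  apply/eqP; rewrite -subr_eq0; apply: contraT => /posx; lra.
have ey : y1 = y2.
  apply/eqP; rewrite -subr_eq0; apply: contraT => /posy; lra.
have ez : z1 = z2.
  by move: feas1; rewrite -feas2 ex ey => /addrI.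
have el : l1 = l2.
  apply/eqP; rewrite -subr_eq0; apply/eqP.
  have uA : A^T \in unitmx by rewrite unitmx_tr; exact/posdef_unit/posdef_A.
  by apply: (can_inj (mulKmx uA)); rewrite dx ex subrr !mulmx0.
by rewrite ex ey ez el.
Qed.

Lemma KKT_exists : exists w : state F, is_KKT w.
Proof.
have [v [fix_v sv]] := exists_fixed_point F.
by eexists; apply: (@fixed_KKT v); rewrite (reduced_map_sign sv).
Qed.

End KKT.

(** * Rationality of the return map *)

Section Rationality.
Variable F : realFieldType.

Lemma ofQ_ofQ m n (Q : 'M[rat]_(m, n)) : ofQ F (ofQ rat Q) = ofQ F Q.
Proof. by apply/matrixP => i j; rewrite !mxE fmorph_rat. Qed.

Lemma ofQD m n (P Q : 'M[rat]_(m, n)) : ofQ F (P + Q) = ofQ F P + ofQ F Q.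
Proof. exact: map_mxD. Qed.

Lemma ofQN m n (P : 'M[rat]_(m, n)) : ofQ F (- P) = - ofQ F P.
Proof. exact: map_mxN. Qed.

Lemma ofQM m n p (P : 'M[rat]_(m, n)) (Q : 'M[rat]_(n, p)) :
  ofQ F (P *m Q) = ofQ F P *m ofQ F Q.
Proof. exact: map_mxM. Qed.

Lemma ofQ_tr m n (P : 'M[rat]_(m, n)) : ofQ F P^T = (ofQ F P)^T.
Proof. by rewrite /ofQ map_trmx. Qed.

Lemma ofQ_inv n (P : 'M[rat]_n) : ofQ F (invmx P) = invmx (ofQ F P).
Proof. exact: map_invmx. Qed.

Lemma ofQ1 n : ofQ F (1%:M : 'M[rat]_n) = 1%:M.
Proof. exact: map_mx1. Qed.

Lemma ofQ0 m n : ofQ F (0 : 'M[rat]_(m, n)) = 0.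
Proof. exact: map_mx0. Qed.

Lemma ofQ_Kx : ofQ F (Kx rat) = Kx F.
Proof. by rewrite /Kx ofQ_inv ofQD ofQM ofQ_tr !ofQ_ofQ. Qed.

Lemma ofQ_Ky : ofQ F (Ky rat) = Ky F.
Proof. by rewrite /Ky ofQ_inv ofQD ofQM ofQ_tr !ofQ_ofQ. Qed.

Lemma ofQ_Dsign s : ofQ F (Dsign rat s) = Dsign F s.
Proof. by apply/matrixP => i j; rewrite !mxE rmorphMn /= ratr_nat. Qed.

Lemma ofQ_lin_step s n (V : 'M[rat]_(3 + 3, n)) w :
  ofQ F (lin_step s V w) = lin_step s (ofQ F V) (ofQ F w).
Proof.
rewrite /lin_step -ofQ_Kx -ofQ_Ky -ofQ_Dsign.
rewrite -(ofQ_ofQ Ahat) -(ofQ_ofQ Bhat) -(ofQ_ofQ bhat) -(ofQ_ofQ c1hat) -(ofQ_ofQ c2hat).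
(* Opaque constants keep unification from computing in rat. *)
move: (Kx rat) (Ky rat) (Dsign rat s) (ofQ rat Ahat) (ofQ rat Bhat) (ofQ rat bhat)
  (ofQ rat c1hat) (ofQ rat c2hat) => kx ky d a b v c1 c2.
have usub (X : 'M[rat]_(3 + 3, n)) : ofQ F (usubmx X) = usubmx (ofQ F X).
  by rewrite /ofQ map_usubmx.
have dsub (X : 'M[rat]_(3 + 3, n)) : ofQ F (dsubmx X) = dsubmx (ofQ F X).
  by rewrite /ofQ map_dsubmx.
rewrite [LHS]map_col_mx -!/(ofQ F _).
by rewrite !(ofQD, ofQN, ofQM, ofQ_tr, ofQ1, usub, dsub).
Qed.

Lemma ofQ_word_mx w : ofQ F (word_mx rat w) = word_mx F w.
Proof.
elim/last_ind: w => [|w s IH]; first exact: ofQ1.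
rewrite !word_mx_rcons /step_mx ofQM IH ofQ_lin_step.
by rewrite ofQ1 ofQ0.
Qed.

Lemma ofQ_Phi_word w v : ofQ F (Phi_word w v) = Phi_word w (ofQ F v).
Proof.
elim/last_ind: w => // w s IH; rewrite /Phi_word !foldl_rcons.
by rewrite !Phi_lin_step ofQ_lin_step IH ofQ1.
Qed.

Lemma ofQ_M_per : ofQ F (M_per rat) = M_per F.
Proof. by rewrite !M_perE ofQ_word_mx. Qed.

Lemma ofQ_vhat j : ofQ F (vhat rat j) = vhat F j.
Proof.
rewrite /vhat ofQ_Phi_word; congr Phi_word.
rewrite /vhat0 ofQM ofQ_inv ofQD ofQN ofQ1 ofQ_M_per.
by rewrite /c_per /Phi_per ofQ_Phi_word ofQ0.
Qed.

End Rationality.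

(** * The Lyapunov function and the ellipsoid *)

Section Lyapunov.
Variable F : realFieldType.

Lemma dot_ge0 n (u : 'cV[F]_n) : 0 <= dot u u.
Proof. by rewrite dotE sumr_ge0 // => i _; rewrite -expr2 sqr_ge0. Qed.

Lemma norm_sqr_le_dot n (u : 'cV[F]_n) : `|u| ^+ 2 <= dot u u.
Proof.
have [->|/eqP] := eqVneq `|u| 0; first by rewrite expr0n dot_ge0.
move=> /eqP/mx_norm_neq0[[i j] /= eq_u].
rewrite [`|u|]eq_u ord1 real_normK ?num_real // dotE (bigD1 i) //= -expr2.
by rewrite lerDl sumr_ge0 // => k _; rewrite -expr2 sqr_ge0.
Qed.

Lemma dot_le_norm_sqr n (u : 'cV[F]_n) : dot u u <= n%:R * `|u| ^+ 2.
Proof.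
rewrite dotE; apply: le_trans (_ : \sum_(i < n) `|u| ^+ 2 <= _); last first.
  by rewrite sumr_const card_ord mulr_natl.
apply: ler_sum => i _; rewrite -expr2 -(real_normK (num_real _)).
by rewrite lerXn2r ?nnegrE ?entry_le_norm.
Qed.

(** The Lyapunov function of a linear map M with small 16th power: from e to
M e, the sum of the squared lengths of the first 16 iterates gains the length of
M^16 e and loses that of e. *)
Definition energy (M : 'M[F]_(3 + 3)) (e : 'cV[F]_(3 + 3)) : F :=
  \sum_(k < 16) dot (M ^+ k *m e) (M ^+ k *m e).

Lemma energy_ge_dot M e : dot e e <= energy M e.
Proof.
rewrite /energy big_ord_recl expr0 mul1mx lerDl sumr_ge0 // => k _.
exact: dot_ge0.
Qed.

Lemma energyM M e :
  energy M (M *m e) = energy M e + dot (M ^+ 16 *m e) (M ^+ 16 *m e) - dot e e.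
Proof.
have shift k : M ^+ k *m (M *m e) = M ^+ k.+1 *m e by rewrite mulmxA exprSr.
rewrite /energy; elim: 16%N => [|n IH].
  by rewrite !big_ord0 expr0 mul1mx add0r subrr.
by rewrite !big_ord_recr /= IH shift; ring.
Qed.

Lemma energy_M_per e :
  energy (M_per F) (M_per F *m e) <= energy (M_per F) e - 3 / 4 * dot e e.
Proof.
rewrite energyM; have := M_per_pow16_norm e; set u := _ *m e => le_u.
have : `|u| ^+ 2 <= (1 / 5 * `|e|) ^+ 2.
  by apply: lerXn2r le_u; rewrite nnegrE // mulr_ge0.
have := norm_sqr_le_dot e; have : dot u u <= 6 * `|u| ^+ 2 := dot_le_norm_sqr u.
have := dot_ge0 e; rewrite exprMn; lra.
Qed.

Lemma word_mx_norm w n (V : 'M[F]_(3 + 3, n)) :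
  {subset w <= W23} -> `|word_mx F w *m V| <= 2 ^+ size w * `|V|.
Proof.
elim/last_ind: w => [_|w s IH sub]; first by rewrite mul1mx expr0 mul1r.
rewrite word_mx_rcons -mulmxA size_rcons exprS -mulrA.
apply: le_trans (step_mx_norm _ _) _; first by apply: sub; rewrite mem_rcons inE eqxx.
rewrite ler_wpM2l // IH // => u uw; apply: sub.
by rewrite mem_rcons inE uw orbT.
Qed.

End Lyapunov.

(** The factor 4^25 makes the ellipsoid so small that no iterate of a period
leaves its sign pattern: 23 steps of norm at most 2 enlarge squared lengths by
at most 4^23, and 4^23 / (4000 * 4^25) = 1/64000 < (1/250)^2. *)
Definition P_cert : 'M[rat]_(3 + 3) :=
  (4 ^+ 25) *: \sum_(k < 16) (M_per rat ^+ k)^T *m (M_per rat ^+ k).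

Section CertifiedEllipsoid.
Variable F : realFieldType.

Lemma ofQ_P_cert : ofQ F P_cert =
  (4 ^+ 25) *: \sum_(k < 16) (M_per F ^+ k)^T *m (M_per F ^+ k).
Proof.
rewrite /P_cert [LHS]map_mxZ rmorphXn /= ratr_nat; congr (_ *: _).
rewrite /ofQ (raddf_sum (map_mx ratr)) /=; apply: eq_bigr => k _.
rewrite -/(ofQ F _) ofQM ofQ_tr.
suff -> : ofQ F (M_per rat ^+ k) = M_per F ^+ k by [].
elim: (k : nat) => [|j IH]; first by rewrite !expr0; exact: ofQ1.
by rewrite !exprS; rewrite [LHS]ofQM IH ofQ_M_per.
Qed.

Lemma form_P_cert e :
  dot e (ofQ F P_cert *m e) = 4 ^+ 25 * energy (M_per F) e.
Proof.
rewrite ofQ_P_cert /dot -scalemxAl -scalemxAr mxE; congr (_ * _).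
rewrite mulmx_suml mulmx_sumr summxE; apply: eq_bigr => k _.
by rewrite /dot trmx_mul !mulmxA.
Qed.

Lemma posdef_P_cert : posdef (ofQ F P_cert).
Proof.
split=> [|u u0].
  rewrite ofQ_P_cert linearZ /= linear_sum /=; congr (_ *: _).
  by apply: eq_bigr => k _; rewrite trmx_mul trmxK.
rewrite form_P_cert mulr_gt0 ?exprn_gt0 //.
apply: lt_le_trans (energy_ge_dot _ _); apply: lt_le_trans (norm_sqr_le_dot _).
by rewrite exprn_gt0 // normr_gt0.
Qed.

Lemma E_certE v : E_cert F P_cert v <->
  energy (M_per F) (v - vhat0 F) < 1 / 4000 / 4 ^+ 25.
Proof.
rewrite ltr_pdivlMr ?exprn_gt0 // mulrC -form_P_cert; split=> [[e -> lt_e]|lt_v].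
  by rewrite addrC addKr.
by exists (v - vhat0 F); rewrite // addrC subrK.
Qed.

Lemma E_cert_vhat0 : E_cert F P_cert (vhat0 F).
Proof.
apply/E_certE; rewrite subrr /energy big1 => [|k _]; last by rewrite /dot !mulmx0 mxE.
by apply: divr_gt0; [lra | apply: exprn_gt0].
Qed.

Lemma Phi_per_sub_vhat0 v : Phi_per v - vhat0 F = M_per F *m (v - vhat0 F).
Proof. by rewrite -{1}vhat0_fixed !Phi_perE mulmxBr opprD addrACA subrr addr0. Qed.

Lemma E_cert_invariant v : E_cert F P_cert v -> E_cert F P_cert (Phi_per v).
Proof.
move=> /E_certE lt_v; apply/E_certE; rewrite Phi_per_sub_vhat0.
apply: le_lt_trans lt_v; apply: le_trans (energy_M_per _) _.
by rewrite gerBl mulr_ge0 ?dot_ge0.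
Qed.

Lemma take_W23 j : {subset take j W23 <= W23}.
Proof. by move=> s; exact: mem_take. Qed.

Lemma orbit_deviation j v :
  (j <= 23)%N ->
  `|Phi_word (take j W23) v - vhat F j| <= 2 ^+ 23 * `|v - vhat0 F|.
Proof.
move=> j23; rewrite /vhat Phi_word_sub.
apply: le_trans (word_mx_norm _ (@take_W23 j)) _; rewrite ler_wpM2r //.
rewrite size_take -[size W23]/23%N ler_eXn2l ?ltr1n //.
by case: ltnP => // _; rewrite ltnW.
Qed.

Lemma E_cert_deviation j v :
  E_cert F P_cert v -> (j <= 23)%N ->
  `|Phi_word (take j W23) v - vhat F j| < 1 / 250.
Proof.
move=> /E_certE lt_v j23; apply: le_lt_trans (orbit_deviation v j23) _.
have {lt_v} := le_lt_trans (le_trans (norm_sqr_le_dot _) (energy_ge_dot _ _)) lt_v.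
have := normr_ge0 (v - vhat0 F); set r := `|_| => r0 lt_r.
rewrite -(@ltr_pXn2r _ 2) ?nnegrE ?mulr_ge0 ?exprn_ge0 //.
rewrite exprMn.
apply: lt_trans (_ : (2 ^+ 23) ^+ 2 * (1 / 4000 / 4 ^+ 25) < _).
  by rewrite ltr_pM2l ?exprn_gt0.
have -> : (2 ^+ 23) ^+ 2 = 4 ^+ 23 :> F by rewrite -exprM mulnC exprM -natrX.
have -> : 4 ^+ 25 = 4 ^+ 23 * 4 ^+ 2 :> F by rewrite -exprD.
have : 4 ^+ 23 != 0 :> F by rewrite expf_neq0 ?pnatr_eq0.
move: (4 ^+ 23) => q q0.
rewrite mulrCA invfM mulVKf //; lra.
Qed.

Lemma E_cert_sign j v :
  E_cert F P_cert v -> (j < 23)%N ->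
  strict_sign (sigma j) (dsubmx (Phi_word (take j W23) v)).
Proof.
move=> Ev j23 i; have := that_separates F j23 i.
have := E_cert_deviation Ev (ltnW j23).
move=> /(le_lt_trans (entry_le_norm _ (rshift 3 i) 0)).
rewrite /that !mxE ltr_norml; set t := Phi_word _ _ _ _; set t' := vhat _ _ _ _.
by case: (tnth _ _) => /andP[]; lra.
Qed.

(** The affine iterates carry the signs of the word, so that each affine piece is
applied exactly where it agrees with the reduced map. *)
Lemma reduced_seq_Phi_word j v :
  E_cert F P_cert v -> (j <= 23)%N ->
  reduced_seq v j = Phi_word (take j W23) v.
Proof.
move=> Ev; elim: j => [|j IH] j23; first by rewrite take0.
rewrite /reduced_seq iterS -/(reduced_seq v j) IH ?(ltnW j23) //.
rewrite (take_nth [tuple false; false; false]) // /Phi_word foldl_rcons.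
exact: reduced_map_sign (E_cert_sign Ev j23).
Qed.

Lemma E_cert_iter l v : E_cert F P_cert v -> E_cert F P_cert (iter l (@Phi_per F) v).
Proof. by move=> Ev; elim: l => //= l; exact: E_cert_invariant. Qed.

Lemma reduced_seq_period v : E_cert F P_cert v -> reduced_seq v 23 = Phi_per v.
Proof. by move=> /reduced_seq_Phi_word ->; rewrite ?take_oversize. Qed.

Lemma reduced_seqE l j v :
  E_cert F P_cert v -> (j <= 23)%N ->
  reduced_seq v (23 * l + j) = Phi_word (take j W23) (iter l (@Phi_per F) v).
Proof.
move=> Ev j23; rewrite -(reduced_seq_Phi_word (E_cert_iter l Ev) j23).
rewrite /reduced_seq addnC iterD; congr iter.
elim: l => // l IH; rewrite mulnS iterD IH [in RHS]iterS.
by have := reduced_seq_period (E_cert_iter l Ev); rewrite /reduced_seq => ->.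
Qed.

Lemma E_cert_follows v : E_cert F P_cert v -> follows_W23 v.
Proof.
move=> Ev l j j23; rewrite reduced_seqE ?(ltnW j23) //.
exact: E_cert_sign (E_cert_iter l Ev) j23.
Qed.

Lemma iter_Phi_per_sub l v :
  iter l (@Phi_per F) v - vhat0 F = M_per F ^+ l *m (v - vhat0 F).
Proof.
elim: l => [|l IH]; first by rewrite expr0 mul1mx.
by rewrite iterS Phi_per_sub_vhat0 IH exprS mulmxA.
Qed.

Lemma reduced_seq_vhat j : (j <= 23)%N -> reduced_seq (vhat0 F) j = vhat F j.
Proof. by move=> j23; rewrite (reduced_seq_Phi_word E_cert_vhat0 j23). Qed.

Lemma reduced_seq_vhat_periodic k :
  reduced_seq (vhat0 F) (k + 23) = reduced_seq (vhat0 F) k.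
Proof.
rewrite /reduced_seq iterD; congr iter.
have := reduced_seq_period E_cert_vhat0; rewrite /reduced_seq => ->.
exact: vhat0_fixed.
Qed.

End CertifiedEllipsoid.

(** * Openness, convergence and the periodic sequence *)

Section Topology.
Variable R : realType.

Lemma continuous_energy (M : 'M[R]_(3 + 3)) (c : 'cV[R]_(3 + 3)) :
  continuous (fun v : 'cV[R]_(3 + 3) => energy M (v - c)).
Proof.
have sumC (I : finType) (f : I -> 'cV[R]_(3 + 3) -> R) :
    (forall i, continuous (f i)) -> continuous (fun v => \sum_i f i v).
  by move=> fC; apply: continuous_big => // x; exact: add_continuous.
apply: (sumC) => k.
have -> : (fun v : 'cV[R]_(3 + 3) => dot (M ^+ k *m (v - c)) (M ^+ k *m (v - c))) =
    (fun v : 'cV[R]_(3 + 3) => \sum_i (M ^+ k *m (v - c)) i 0 * (M ^+ k *m (v - c)) i 0).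
  by apply/funext => v; rewrite dotE.
apply: (sumC) => i.
have entryC : continuous (fun v : 'cV[R]_(3 + 3) => (M ^+ k *m (v - c)) i 0).
  have -> : (fun v : 'cV[R]_(3 + 3) => (M ^+ k *m (v - c)) i 0) =
      (fun v => \sum_j (M ^+ k) i j * (v j 0 - c j 0)).
    by apply/funext => v; rewrite mxE; apply: eq_bigr => j _; rewrite !mxE.
  apply: (sumC) => j v.
  have prodC := @continuousM R 'cV[R]_(3 + 3) (fun=> (M ^+ k) i j) (fun v => v j 0 - c j 0) v.
  have diffC := @continuousB R R^o 'cV[R]_(3 + 3) (fun v => v j 0) (fun=> c j 0) v.
  apply prodC; first exact: cst_continuous.
  apply diffC; [exact: coord_continuous | exact: cst_continuous].
by move=> v; exact: (continuousM (entryC v) (entryC v)).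
Qed.

Lemma open_E_cert : open (E_cert R P_cert).
Proof.
rewrite (_ : E_cert R P_cert =
    (fun v : 'cV[R]_(3 + 3) => energy (M_per R) (v - vhat0 R)) @^-1`
    [set x | x < 1 / 4000 / 4 ^+ 25]).
  have /continuousP oE := @continuous_energy (M_per R) (vhat0 R).
  exact/oE/open_lt.
by apply/seteqP; split=> v /E_certE.
Qed.

(** The energy decreases along the iterates of the return map, hence converges,
and each decrement bounds the squared distance to the fixed point. *)
Lemma iter_Phi_per_cvg v : (fun l => `|iter l (@Phi_per R) v - vhat0 R|) @ \oo --> (0 : R).
Proof.
set e := v - vhat0 R; pose a l := energy (M_per R) (M_per R ^+ l *m e).
have aS l : a l.+1 <= a l - 3 / 4 * dot (M_per R ^+ l *m e) (M_per R ^+ l *m e).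
  by rewrite /a exprS -mulmxA energy_M_per.
have dec : nonincreasing_seq a.
  apply/nonincreasing_seqP => l; apply: le_trans (aS l) _.
  by rewrite gerBl mulr_ge0 ?dot_ge0.
have a_cvg : cvgn a.
  apply: nonincreasing_is_cvgn dec _; exists 0 => _ [l _ <-].
  exact: le_trans (dot_ge0 _) (energy_ge_dot _ _).
have diff0 : (fun l => a l - a l.+1) @ \oo --> (0 : R).
  rewrite -(subrr (limn a)); apply: cvgB => //.
  by have := a_cvg; rewrite -(cvg_shiftS a).
apply/cvgrPdist_lt => eps eps0; near=> l.
have small : `|a l - a l.+1| < 3 / 4 * eps ^+ 2.
  near: l; move/cvgrPdist_lt : diff0 => /(_ (3 / 4 * eps ^+ 2)).
  have pos : 0 < 3 / 4 * eps ^+ 2 by rewrite mulr_gt0 ?exprn_gt0.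
  by move=> /(_ pos); apply: filterS => l; rewrite sub0r normrN.
rewrite sub0r normrN normr_id iter_Phi_per_sub -/e.
rewrite -(@ltr_pXn2r _ 2) ?nnegrE ?(ltW eps0) //.
have := norm_sqr_le_dot (M_per R ^+ l *m e); have := aS l.
have := ler_norm (a l - a l.+1); lra.
Unshelve. all: by end_near.
Qed.

Lemma reduced_seq_cvg v j :
  E_cert R P_cert v -> (j < 23)%N ->
  (fun l => reduced_seq v (23 * l + j)) @ \oo --> vhat R j.
Proof.
move=> Ev /ltnW j23; apply/cvgrPdist_lt => eps eps0.
have /cvgrPdist_lt/(_ (eps / 2 ^+ 23)) := iter_Phi_per_cvg v.
have q0 : 0 < 2 ^+ 23 :> R by rewrite exprn_gt0.
rewrite divr_gt0 // => /(_ isT); apply: filterS => l.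
rewrite sub0r normrN normr_id ltr_pdivlMr // mulrC => small.
rewrite distrC reduced_seqE //; apply: le_lt_trans small.
exact: orbit_deviation.
Qed.

(** The first entry of z + lambda tends to a positive number along phase 0 and to
a negative one along phase 5. *)
Lemma reconstruct_not_cvg v x0 :
  E_cert R P_cert v -> ~ exists w : state R, admm_seq (reconstruct x0 v) @ \oo --> w.
Proof.
move=> Ev [[[[x y] z] l] w_cvg].
pose c := z 0 0 + l 0 0; pose i0 : 'I_(3 + 3) := rshift 3 0.
have t_cvg : (fun k => reduced_seq v k i0 0) @ \oo --> c.
  have -> : (fun k => reduced_seq v k i0 0) =
      (fun w : state R => w.1.2 0 0 + w.2 0 0) \o admm_seq (reconstruct x0 v).
    apply/funext => k; rewrite /= -(reduced_state_admm_seq x0).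
    by case: (admm_seq _ _) => [[[? ?] ?] ?]; rewrite /= /i0 col_mxEd mxE.
  apply: cvg_comp w_cvg _; apply: cvgD.
    apply: (@cvg_comp _ _ _ (fun w : state R => w.1.2) (fun z => z 0 0)).
      apply: cvg_comp; [exact: cvg_fst | exact: cvg_snd].
    exact: coord_continuous.
  apply: (@cvg_comp _ _ _ (fun w : state R => w.2) (fun z => z 0 0)).
    exact: cvg_snd.
  exact: coord_continuous.
have eq_c j : (j < 23)%N -> c = that R j 0 0.
  move=> j23; rewrite /that mxE.
  have sub : (fun l : nat => (23 * l + j)%N) @ \oo --> \oo.
    by apply: cvg_comp (@cvg_addnr j); exact: cvg_mulnl.
  have c1 := cvg_comp _ _ sub t_cvg.
  have c2 : (fun l : nat => reduced_seq v (23 * l + j) i0 0) @ \oo --> vhat R j i0 0.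
    apply: (@cvg_comp _ _ _ _ (fun u : 'cV[R]_(3 + 3) => u i0 0) _ _ _ (reduced_seq_cvg Ev j23)).
    exact: coord_continuous.
  exact: (cvg_unique _ c1 c2).
have := that_separates R (isT : (0 < 23)%N) 0; rewrite -eq_c // (tnth_nth false).
have := that_separates R (isT : (5 < 23)%N) 0; rewrite -eq_c // (tnth_nth false).
rewrite /=; lra.
Qed.

End Topology.

Section PeriodicOrbit.
Variable F : realFieldType.

Definition next_x (v : 'cV[F]_(3 + 3)) : 'cV[F]_3 :=
  x_update (usubmx v) (pos_part (dsubmx v)) (neg_part (dsubmx v)).

Lemma admm_seq_reconstructS x v k :
  admm_seq (reconstruct x v) k.+1 =
  reconstruct (next_x (reduced_seq v k)) (reduced_seq v k.+1).
Proof.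
elim: k => [|k IH]; first exact: admm_step_reconstruct.
by rewrite [LHS]iterS -/(admm_seq _ k.+1) IH admm_step_reconstruct.
Qed.

(* x is not part of the reduced state: its periodic value is the one produced by
the last step of the period. *)
Definition periodic_start : state F := reconstruct (next_x (vhat F 22)) (vhat0 F).

Lemma reduced_state_periodic k :
  (k < 23)%N -> reduced_state (admm_seq periodic_start k) = vhat F k.
Proof. by move=> k23; rewrite reduced_state_admm_seq reduced_seq_vhat // ltnW. Qed.

Lemma periodic k :
  admm_seq periodic_start (k + 23) = admm_seq periodic_start k.
Proof.
rewrite /admm_seq iterD; congr iter.
have := admm_seq_reconstructS (next_x (vhat F 22)) (vhat0 F) 22.
rewrite (reduced_seq_vhat F (isT : (22 <= 23)%N)) (reduced_seq_vhat_periodic F 0).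
by rewrite /admm_seq => ->.
Qed.

(** Only the first sign matters, positive in phases 0 to 4 and negative in phases
5 to 22. A shift by q >= 5 moves phase 0 to phase q, and a shift by less than 5
moves phase 4 to phase 4 + q. *)
Lemma no_smaller_period q : (0 < q < 23)%N ->
  ~ (forall k, admm_seq periodic_start (k + q) = admm_seq periodic_start k).
Proof.
move=> /andP[q0 q23] per.
have t_eq k : (k + q < 23)%N -> that F (k + q) 0 0 = that F k 0 0.
  move=> kq; rewrite /that -!reduced_state_periodic ?per //.
  by apply: leq_ltn_trans kq; exact: leq_addr.
have pos k : (k < 5)%N -> 0 < that F k 0 0.
  move=> k5; have := that_separates F (ltn_trans k5 (isT : 5 < 23)%N) 0.
  have -> : tnth (sigma k) 0 = true.
    by rewrite (tnth_nth false); do 5? [case: k k5 => [|k] // k5].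
  lra.
have neg k : (4 < k < 23)%N -> that F k 0 0 < 0.
  move=> /andP[k4 k23]; have := that_separates F k23 0.
  have -> : tnth (sigma k) 0 = false.
    by rewrite (tnth_nth false); do 23? [case: k k4 k23 => [|k] // k4 k23].
  lra.
have [q4|q4] := ltnP 4 q.
  have := t_eq 0%N; rewrite add0n => /(_ q23).
  have := pos 0%N isT; have := neg q; rewrite q4 q23 => /(_ isT); lra.
have q27 : (4 + q < 23)%N by apply: leq_ltn_trans (_ : 4 + 4 < 23)%N; rewrite ?leq_add2l.
have := t_eq 4%N q27; have := pos 4%N isT; have := neg (4 + q)%N.
rewrite q27 -[X in (X < 4 + q)%N]addn0 ltn_add2l q0 => /(_ isT); lra.
Qed.

(** ADMM stays at a KKT point, which would make the whole periodic sequence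
constant. *)
Lemma periodic_not_KKT k : ~ is_KKT (admm_seq periodic_start k).
Proof.
move=> /KKT_fixed fixk; apply: (@no_smaller_period 1) => // m.
have step_fix n : admm_seq periodic_start (n + k) = admm_seq periodic_start k.
  by elim: n => // n IH; rewrite addSn [LHS]iterS -/(admm_seq _ _) IH.
have all_fix n : admm_seq periodic_start n = admm_seq periodic_start k.
  have per j : admm_seq periodic_start (n + j * 23) = admm_seq periodic_start n.
    by elim: j => [|j IH]; rewrite ?mul0n ?addn0 // mulSn addnCA addnC periodic.
  rewrite -(per k) -(step_fix (n + k * 22)%N) -addnA -mulnSr.
  by [].
by rewrite !all_fix.
Qed.

End PeriodicOrbit.

Theorem proposition4p1 (R : realType) :
  [/\ posdef (ofQ R Qxhat), posdef (ofQ R Qyhat) & \det Ahat * \det Bhat != 0]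
  /\
  (* (i) *)
  (exists! w : state R, is_KKT w)
  /\
  (* well-definedness and rationality of the phase-0 state *)
  (1%:M - M_per R \in unitmx /\
   exists q : 'cV[rat]_(3 + 3), vhat R 0 = ofQ R q)
  /\
  (* (ii) *)
  [/\ exists w0 : state R,
        [/\ minimal_period 23 (admm_seq w0),
            forall k : nat, ~ is_KKT (admm_seq w0 k) &
            forall k : nat, (k < 23)%N ->
              reduced_state (admm_seq w0 k) = vhat R k],
      forall k : nat, (k < 23)%N -> strict_sign (sigma k) (that R k) &
      forall (k : nat) (i : 'I_3), (k < 23)%N -> 1 / 250 < `|that R k i 0| ]
  /\
  (* (iii) and its consequence *)
  (exists P : 'M[rat]_(3 + 3),
    [/\ posdef (ofQ R P),
        open (E_cert R P) /\
          (forall v : 'cV[R]_(3 + 3), E_cert R P v -> E_cert R P (Phi_per v)),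
        forall v0 : 'cV[R]_(3 + 3), E_cert R P v0 -> follows_W23 v0,
        forall v0 : 'cV[R]_(3 + 3), E_cert R P v0 -> forall j : nat, (j < 23)%N ->
          (fun l : nat => reduced_seq v0 (23 * l + j)) @ \oo --> vhat R j &
        forall v0 : 'cV[R]_(3 + 3), E_cert R P v0 -> forall x0 : 'cV[R]_3,
          ~ exists w : state R, admm_seq (reconstruct x0 v0) @ \oo --> w]).
Proof.
split.
  split; [exact: posdef_Qx | exact: posdef_Qy |].
  rewrite mulf_neq0 // det_ofQ_unit //; apply: posdef_unit;
    [exact: posdef_A | exact: posdef_B].
split.
  have [w KKTw] := KKT_exists R; exists w; split=> // w'; exact: KKT_unique.
split.
  split; first by case: (IM_per_enclosure R).
  by exists (vhat rat 0); rewrite ofQ_vhat.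
split.
  split.
  - exists (periodic_start R); split.
    + split=> //; [exact: periodic | exact: no_smaller_period].
    + exact: periodic_not_KKT.
    + exact: reduced_state_periodic.
  - by move=> k k23 i; have := that_separates R k23 i; case: (tnth _ i); lra.
  - move=> k i k23; have := that_separates R k23 i.
    by case: (tnth _ i) => sep; rewrite ltr_normr; apply/orP; [left | right]; lra.
exists P_cert; split.
- exact: posdef_P_cert.
- by split; [exact: open_E_cert | exact: E_cert_invariant].
- exact: E_cert_follows.
- by move=> v0 Ev j j23; exact: reduced_seq_cvg.
- by move=> v0 Ev x0; exact: reconstruct_not_cvg.
Qed.
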